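(* Let $\mathrm{Gr}_{\mathbf b}(k,n)$ be a divisive weighted Grassmann orbifold, with $b_i$ dividing $b_{i-1}$ for all $i=1,\dots,m$. Let $i,j,\ell\in\{0,\dots,m\}$ with $d(\lambda^i)+d(\lambda^j)=d(\lambda^\ell)$. Then the structure constant ${\bf b}\mathscr C_{i\,j}^{\ell}$ of the integral cohomology ring $H^*(\mathrm{Gr}_{\mathbf b}(k,n);\mathbb Z)$ is given by $${\bf b}\mathscr C_{i\,j}^{\ell}=\mathscr C_{i\,j}^{\ell}+\sum_{q:\ \lambda^\ell\succ\lambda^q\succeq\lambda^i,\lambda^j}\mathscr D_{i\,j}^{\ell\,q},$$ where $\lambda^q\succeq\lambda^i,\lambda^j$ means $\lambda^q\succeq\lambda^i$ and $\lambda^q\succeq\lambda^j$, $\mathscr C_{i\,j}^{\ell}$ is the corresponding structure constant of $H^*(\mathrm{Gr}(k,n);\mathbb Z)$ (the case $\mathbf b=(1,\dots,1)$), and $$\mathscr D_{i\,j}^{\ell\,q}=\sum_{\lambda^\ell=\lambda^{\ell_0}\to\lambda^{\ell_1}\to\dots\to\lambda^{\ell_d}=\lambda^q}\frac{\widetilde{\mathscr C}_{i\,j}^{q}(\mathbf b)}{b_{\ell_1}b_{\ell_2}\cdots b_{\ell_d}},\qquad d=d(\lambda^\ell)-d(\lambda^q).$$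
   Context: Let $1\le k<n$ and $m+1=\binom nk$. A Schubert symbol for $k<n$ is a sequence $\lambda=(\lambda_1<\dots<\lambda_k)$ of integers in $\{1,\dots,n\}$ (identified with its underlying set). Write $\lambda\preceq\mu$ iff $\lambda_i\le\mu_i$ for all $i$, and fix a total order $\lambda^0<\lambda^1<\dots<\lambda^m$ of all Schubert symbols refining $\preceq$. With $e_1,\dots,e_n$ the standard basis of $\mathbb C^n$ and $e_\lambda=e_{\lambda_1}\wedge\dots\wedge e_{\lambda_k}$, identify $\Lambda^k(\mathbb C^n)$ with $\mathbb C^{m+1}$ by $z=\sum_i z_ie_{\lambda^i}$. Let $Pl(k,n)=\{a_1\wedge\dots\wedge a_k: a_i\in\mathbb C^n\}\setminus\{0\}$. $\mathbf b=(b_0,\dots,b_m)\in(\mathbb Z_{\ge1})^{m+1}$ is a Plücker weight vector if for all $1\le i_1<\dots<i_{k-1}\le n$ and $1\le\ell_0<\dots<\ell_k\le n$ the sum $b_{r_j}+b_{s_j}$ takes the same value for all $j\in\{0,\dots,k\}$ with $\ell_j\notin\{i_1,\dots,i_{k-1}\}$, where $\lambda^{r_j}=\{i_1,\dots,i_{k-1},\ell_j\}$ and $\lambda^{s_j}=\{\ell_0,\dots,\ell_k\}\setminus\{\ell_j\}$. For such $\mathbf b$, $\mathbb C^*$ acts on $Pl(k,n)$ by $t(z_0,\dots,z_m)=(t^{b_0}z_0,\dots,t^{b_m}z_m)$, and $\mathrm{Gr}_{\mathbf b}(k,n)$ is the orbit space with the quotient topology (a weighted Grassmann orbifold). A Plücker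 permutation is a permutation $\sigma$ of $\{0,\dots,m\}$ for which there are signs $t_i\in\{1,-1\}$ such that $(t_0z_{\sigma(0)},\dots,t_mz_{\sigma(m)})\in Pl(k,n)$ for every $z\in Pl(k,n)$; $\mathrm{Gr}_{\mathbf b}(k,n)$ is divisive if for some Plücker permutation $\sigma$, $b_{\sigma(i)}$ divides $b_{\sigma(i-1)}$ for all $i=1,\dots,m$. Up to homeomorphism one assumes (standing convention) that $b_i$ divides $b_{i-1}$ for all $i=1,\dots,m$. Put $d(\lambda)=\sum_{r=1}^k(\lambda_r-r)$. For $s\in\lambda$, $s'\notin\lambda$, $s<s'$, let $(s,s')\lambda$ be the symbol obtained by replacing $s$ by $s'$ in $\lambda$. Let $I(\lambda^i)$ be the set of all $(s,s')\lambda^i$, and $R(\lambda^i)=\{\lambda^j:\lambda^i\in I(\lambda^j)\}$. Write $\lambda^j\to\lambda^i$ if $\lambda^i\preceq\lambda^j$ and $d(\lambda^j)=d(\lambda^i)+1$. Put $Y_\lambda=\sum_{r=1}^ky_{\lambda_r}$. $T^n=(S^1)^n$ acts on $\mathrm{Gr}_{\mathbf b}(k,n)$ by $t\cdot[(z_i)]=[(t_{\lambda^i}z_i)]$, $t_\lambda=t_{\lambda_1}\cdots t_{\lambda_k}$, and $H^*_{T^n}(\mathrm{pt};\mathbb Z)=\mathbb Z[y_1,\dots,y_n]$. Restriction to the fixed points $[e_{\lambda^j}]$ (written $\alpha|_{\lambda^j}=\alpha_j$) identifies (known) $$H^*_{T^n}(\mathrm{Gr}_{\mathbf b}(k,n);\mathbb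 Z)=\Big\{\alpha\in\bigoplus_{j=0}^m\mathbb Z[y_1,\dots,y_n]:\ \big(Y_{\lambda^i}-\tfrac{b_i}{b_j}Y_{\lambda^j}\big)\text{ divides }(\alpha_j-\alpha_i)\text{ whenever }\lambda^i\in R(\lambda^j)\Big\}.$$ The equivariant Schubert class ${\bf b}\widetilde{\mathbb S}_{\lambda^i}$ is the unique element with: (1) ${\bf b}\widetilde{\mathbb S}_{\lambda^i}|_{\lambda^j}\ne0\Rightarrow\lambda^j\succeq\lambda^i$; (2) ${\bf b}\widetilde{\mathbb S}_{\lambda^i}|_{\lambda^i}=\prod_{\lambda^\ell\in R(\lambda^i)}(Y_{\lambda^\ell}-\frac{b_\ell}{b_i}Y_{\lambda^i})$; (3) each ${\bf b}\widetilde{\mathbb S}_{\lambda^i}|_{\lambda^j}$ is a homogeneous polynomial in $y_1,\dots,y_n$ of degree $d(\lambda^i)$. These classes form a $\mathbb Z[y_1,\dots,y_n]$-basis of this ring. For $\mathbf b=(1,\dots,1)$ write them $\widetilde{\mathbb S}_{\lambda^i}$ and define $\widetilde{\mathscr C}_{i\,j}^{\ell}$ by $\widetilde{\mathbb S}_{\lambda^i}\widetilde{\mathbb S}_{\lambda^j}=\sum_\ell\widetilde{\mathscr C}_{i\,j}^{\ell}\widetilde{\mathbb S}_{\lambda^\ell}$. Ordinary cohomology: $H^*(\mathrm{Gr}_{\mathbf b}(k,n);\mathbb Z)\cong H^*_{T^n}(\mathrm{Gr}_{\mathbf b}(k,n);\mathbb Z)\otimes_{\mathbb Z[y_1,\dots,y_n]}\mathbb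 Z$ with all $y_i\mapsto0$; let $\xi$ be the resulting forgetful map and ${\bf b}\mathbb S_{\lambda^i}=\xi({\bf b}\widetilde{\mathbb S}_{\lambda^i})\in H^{2d(\lambda^i)}$. These form a $\mathbb Z$-basis, and ${\bf b}\mathscr C_{i\,j}^{\ell}$ are defined by ${\bf b}\mathbb S_{\lambda^i}{\bf b}\mathbb S_{\lambda^j}=\sum_{\ell:\,d(\lambda^\ell)=d(\lambda^i)+d(\lambda^j)}{\bf b}\mathscr C_{i\,j}^{\ell}\,{\bf b}\mathbb S_{\lambda^\ell}$; for $\mathbf b=(1,\dots,1)$ they are written $\mathscr C_{i\,j}^{\ell}$. Evaluation at $\mathbf b$: with $u_r=y_r-y_{r+1}$ ($1\le r\le n-1$) and $U_R=\prod_{r\in R}u_r$ for a finite multiset $R$ in $\{1,\dots,n-1\}$, write (Knutson–Tao) $\widetilde{\mathscr C}_{i\,j}^{q}=\sum_{|R|=d(\lambda^i)+d(\lambda^j)-d(\lambda^q)}K(i,j,q,R)U_R$ with $K(i,j,q,R)\in\mathbb Z_{\ge0}$. Put $b(u_r)=b_e-b_f$ for any $e,f$ with $y_r-y_{r+1}=Y_{\lambda^e}-Y_{\lambda^f}$ (well defined for a Plücker weight vector), $b(U_R)=\prod_{r\in R}b(u_r)$, and $$\widetilde{\mathscr C}_{i\,j}^{q}(\mathbf b)=\sum_{|R|=d(\lambda^i)+d(\lambda^j)-d(\lambda^q)}K(i,j,q,R)\,b(U_R).$$ *)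

(* Defs.v *)
From HB Require Import structures.
From mathcomp Require Import all_boot all_order all_algebra.
From mathcomp Require Import ring_quotient.
From mathcomp Require Import boolp.
From mathcomp Require Export mpoly.

Set Implicit Arguments.
Unset Strict Implicit.
Unset Printing Implicit Defensive.

Import GRing.Theory.
Local Open Scope ring_scope.

(* Indices are 0-based: {1..n} is 'I_n and positions in a symbol are 'I_k. *)

Definition incr n k (f : {ffun 'I_k -> 'I_n}) : bool :=
  [forall r : 'I_k, forall s : 'I_k, (r < s)%N ==> (f r < f s)%N].

Record symbol n k := Symbol { sfun :> {ffun 'I_k -> 'I_n}; _ : incr sfun }.
HB.instance Definition _ n k := [isSub for @sfun n k].
HB.instance Definition _ n k := [Finite of symbol n k by <:].

Section Symbols.
Variables n k : nat.
Implicit Types a c : symbol n k.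

Definition sset a : {set 'I_n} := [set a r | r : 'I_k].

Definition sle a c : bool := [forall r : 'I_k, (a r <= c r)%N].
Definition slt a c : bool := sle a c && (a != c).

(* The shift by one in [a r] and in [r] cancels.  Each term is nonnegative
   because a symbol is increasing, so the truncated subtraction is exact. *)
Definition sdim a : nat := (\sum_(r < k) (a r - r))%N.

Definition Iset a : {set symbol n k} :=
  [set c | [exists s : 'I_n, exists s' : 'I_n,
     [&& s \in sset a, s' \notin sset a, (s < s')%N
       & sset c == s' |: (sset a :\ s)]]].
Definition Rset a : {set symbol n k} := [set c | a \in Iset c].

Definition scover c a : bool := sle a c && (sdim c == (sdim a).+1).

Definition Ysym a : {mpoly int[n]} := \sum_(r < k) 'X_(a r).

End Symbols.

Section Weighted.
Variables (n k m : nat) (lam : 'I_m.+1 -> symbol n k) (b : 'I_m.+1 -> nat).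

(* [I] is {i_1 < ... < i_(k-1)} and [L] is {l_0 < ... < l_k}; [x] and [x']
   are two of the l_j outside [I]. *)
Definition plucker_weight : Prop :=
  (forall i, (0 < b i)%N) /\
  forall I L : {set 'I_n}, #|I| = k.-1 -> #|L| = k.+1 ->
  forall x x' : 'I_n, x \in L :\: I -> x' \in L :\: I ->
  forall r s r' s' : 'I_m.+1,
    sset (lam r) = x |: I -> sset (lam s) = L :\ x ->
    sset (lam r') = x' |: I -> sset (lam s') = L :\ x' ->
    (b r + b s = b r' + b s')%N.

(* Divisiveness in its normalized form, witnessed by the identity Pluecker
   permutation. *)
Definition divisive_order : Prop :=
  forall i j : 'I_m.+1, j = i.+1 :> nat -> (b j %| b i)%N.

(* Y_(lam i) - (b_i / b_j) Y_(lam j).  It is used only when lam i is in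
   R(lam j); then i < j, so b_j divides b_i under [divisive_order] and the
   natural number quotient is exact. *)
Definition wroot (i j : 'I_m.+1) : {mpoly int[n]} :=
  Ysym (lam i) - (b i %/ b j)%:R * Ysym (lam j).

Definition gkm (al : {ffun 'I_m.+1 -> {mpoly int[n]}}) : bool :=
  `[< forall i j, lam i \in Rset (lam j) ->
      exists g, al j - al i = wroot i j * g >].

Lemma gkm_subring : GRing.subring_closed gkm.
Proof.
split.
- by apply/asboolP => i j _; exists 0; rewrite !ffunE subrr mulr0.
- move=> x y /asboolP hx /asboolP hy; apply/asboolP => i j hij.
  have [g Hg] := hx _ _ hij; have [h Hh] := hy _ _ hij.
  exists (g - h); rewrite mulrBr -Hg -Hh !ffunE.
  by rewrite opprD opprK [in RHS]opprB addrACA [- y j + _]addrC.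
- move=> x y /asboolP hx /asboolP hy; apply/asboolP => i j hij.
  have [g Hg] := hx _ _ hij; have [h Hh] := hy _ _ hij.
  exists (g * y j + x i * h).
  rewrite mulrDr mulrA -Hg mulrCA -Hh !ffunE.
  by rewrite mulrBl mulrBr addrA subrK.
Qed.

HB.instance Definition _ := GRing.isSubringClosed.Build _ gkm gkm_subring.

(* The ring H^*_{T^n}(Gr_b(k,n); Z), in its description by restrictions to
   the fixed points. *)
Record HT : Type := MkHT { HTval : {ffun 'I_m.+1 -> {mpoly int[n]}};
                           _ : HTval \in gkm }.

HB.instance Definition _ := [isSub for HTval].
HB.instance Definition _ := [Choice of HT by <:].
HB.instance Definition _ :=
  GRing.SubChoice_isSubPzRing.Build _ gkm HT gkm_subring.

Lemma HT_mulrC : commutative (@GRing.mul HT).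
Proof.
move=> x y; apply/val_inj; rewrite !rmorphM.
by apply/ffunP => j; rewrite !ffunE mulrC.
Qed.
HB.instance Definition _ := GRing.PzRing_hasCommutativeMul.Build HT HT_mulrC.

Lemma HT_oner_neq0 : (1 : HT) != 0.
Proof.
apply/eqP => /(congr1 val) /ffunP /(_ ord0) /eqP.
by rewrite rmorph1 raddf0 !ffunE oner_eq0.
Qed.
HB.instance Definition _ := GRing.PzSemiRing_isNonZero.Build HT HT_oner_neq0.

Definition restr (al : HT) (j : 'I_m.+1) : {mpoly int[n]} := val al j.

Lemma gkm_const (p : {mpoly int[n]}) : [ffun=> p] \in gkm.
Proof. by apply/asboolP => i j _; exists 0; rewrite !ffunE subrr mulr0. Qed.

(* The structure map Z[y_1, ..., y_n] -> H^*_{T^n}. *)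
Definition HTconst (p : {mpoly int[n]}) : HT := MkHT (gkm_const p).

(* The ideal of H^*_{T^n} generated by y_1, ..., y_n. *)
Definition yideal (al : HT) : bool :=
  `[< exists g : 'I_n -> HT, al = \sum_(r < n) HTconst 'X_r * g r >].

Lemma yideal_idealr : idealr_closed yideal.
Proof.
split.
- apply/asboolP; exists (fun=> 0).
  by rewrite big1 // => r _; rewrite mulr0.
- apply/asboolP => -[g /(congr1 (fun al => (restr al ord0).@[fun=> 0]))].
  rewrite /restr raddf_sum sum_ffunE raddf_sum /= !ffunE rmorph1 big1.
    by move/eqP; rewrite oner_eq0.
  by move=> r _; rewrite !ffunE mevalM mevalXU mul0r.
- move=> a x y /asboolP [g ->] /asboolP [h ->]; apply/asboolP.
  exists (fun r => a * g r + h r); rewrite mulr_sumr -big_split /=.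
  by apply: eq_bigr => r _; rewrite mulrDr mulrCA.
Qed.

HB.instance Definition _ := isIdealr.Build HT yideal yideal_idealr.
Definition yI : idealr HT := yideal.

(* The ring H^*(Gr_b(k,n); Z), as H^*_{T^n} tensored over Z[y_1, ..., y_n]
   with Z (all y_r acting by 0), that is, H^*_{T^n} / (y_1, ..., y_n). *)
Definition Hord : comNzRingType := {ideal_quot yI}.

Definition xi : {rmorphism HT -> Hord} := (\pi_{ideal_quot yI})%qT.

Definition is_schubert_class (i : 'I_m.+1) (al : HT) : Prop :=
  [/\ forall j, restr al j != 0 -> sle (lam i) (lam j),
      restr al i = \prod_(l | lam l \in Rset (lam i)) wroot l i
    & forall j, restr al j \is (sdim (lam i)).-homog].

Definition equiv_structure_constants (S : 'I_m.+1 -> HT)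
    (c : 'I_m.+1 -> 'I_m.+1 -> 'I_m.+1 -> {mpoly int[n]}) : Prop :=
  forall i j, S i * S j = \sum_l HTconst (c i j l) * S l.

Definition structure_constants (S : 'I_m.+1 -> HT)
    (c : 'I_m.+1 -> 'I_m.+1 -> 'I_m.+1 -> int) : Prop :=
  forall i j, xi (S i) * xi (S j) =
    \sum_(l | (sdim (lam l) == sdim (lam i) + sdim (lam j))%N)
      xi (S l) *~ c i j l.

End Weighted.

Section Evaluation.
Variable n : nat.

Lemma succ_ord_subproof (r : 'I_n.-1) : (r.+1 < n)%N.
Proof. by case: n r => [[]|p] //= [r]. Qed.

Definition ord_cur (r : 'I_n.-1) : 'I_n := widen_ord (leq_pred n) r.
Definition ord_next (r : 'I_n.-1) : 'I_n := Ordinal (succ_ord_subproof r).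

Definition udiff (r : 'I_n.-1) : {mpoly int[n]} := 'X_(ord_cur r) - 'X_(ord_next r).

(* A finite multiset R in {1..n-1} is its multiplicity function, a
   multinomial in 'X_{1..n.-1}; its cardinality is [mdeg R]. *)
Definition Umon (R : 'X_{1..n.-1}) : {mpoly int[n]} :=
  \prod_(r < n.-1) udiff r ^+ R r.

Variables (k m : nat) (lam : 'I_m.+1 -> symbol n k) (b : 'I_m.+1 -> nat).

(* [bu r] is b(u_r), computed from some e, f with u_r = Y_e - Y_f. *)
Definition is_b_of_u (bu : 'I_n.-1 -> int) : Prop :=
  forall r, exists e f : 'I_m.+1,
    udiff r = Ysym (lam e) - Ysym (lam f) /\ bu r = (b e)%:Z - (b f)%:Z.

(* The sums over R below have |R| = d(lam i) + d(lam j) - d(lam q); written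
   additively, they are empty when the right-hand side is negative.  The
   bound on the degree of R in the index type only makes it finite. *)
Definition knutson_tao_expansion
    (Ct : 'I_m.+1 -> 'I_m.+1 -> 'I_m.+1 -> {mpoly int[n]})
    (K : 'I_m.+1 -> 'I_m.+1 -> 'I_m.+1 -> 'X_{1..n.-1} -> nat) : Prop :=
  forall i j q, Ct i j q =
    \sum_(R : 'X_{1..n.-1 < (sdim (lam i) + sdim (lam j)).+1} |
          (mdeg R + sdim (lam q) == sdim (lam i) + sdim (lam j))%N)
      (K i j q R)%:R * Umon R.

Definition Ceval (K : 'I_m.+1 -> 'I_m.+1 -> 'I_m.+1 -> 'X_{1..n.-1} -> nat)
    (bu : 'I_n.-1 -> int) (i j q : 'I_m.+1) : int :=
  \sum_(R : 'X_{1..n.-1 < (sdim (lam i) + sdim (lam j)).+1} |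
        (mdeg R + sdim (lam q) == sdim (lam i) + sdim (lam j))%N)
    (K i j q R)%:R * \prod_(r < n.-1) bu r ^+ (R : 'X_{1..n.-1}) r.

(* A chain lam l = lam l_0 -> lam l_1 -> ... -> lam l_d = lam q is stored as
   the tuple [ch] of indices (l_1, ..., l_d). *)
Definition Dterm (Cb : 'I_m.+1 -> 'I_m.+1 -> 'I_m.+1 -> int)
    (i j l q : 'I_m.+1) : rat :=
  \sum_(ch : (sdim (lam l) - sdim (lam q)).-tuple 'I_m.+1 |
        path (fun x y => scover (lam x) (lam y)) l ch && (last l ch == q))
    (Cb i j q)%:~R / \prod_(t <- ch) (b t)%:R.

End Evaluation.

(* Main.v *)
From HB Require Import structures.
Require Import Defs.
From mathcomp Require Import all_boot all_order all_algebra.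
From mathcomp Require Import ring zify.
From mathcomp Require Import perm ring_quotient boolp.

Set Implicit Arguments.
Unset Strict Implicit.
Unset Printing Implicit Defensive.

Import Order.TTheory GRing.Theory Num.Theory.
Local Open Scope ring_scope.

(* Write the Pluecker weights as b_lam = 1 + sum_(r in lam) e_r with rational
   e_r.  At the vertex p, the linear substitution
   y_r |-> y_r - (e_r / b_p) Y_p is an automorphism of Q[y] that turns
   Y_l - Y_p into Y_l - (b_l / b_p) Y_p.  Applied vertex by vertex it maps the
   unweighted GKM ring to the weighted one, and by uniqueness it maps Schubert
   classes to Schubert classes.  Hence the weighted product of two classes is
   the image of the expansion with coefficients Ct, in which
   u_r becomes u_r + b(u_r) D with D = (- Y_p / b_p)_p.  Modulo the variables
   only b(U_R) D^|R| survives, and the equivariant Chevalley formula gives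
   D * S_q = b_q^-1 * sum_(x -> q) S_x modulo the variables; iterating it
   produces the sum over chains.  Coordinates modulo the variables are well
   defined because the classes are a basis over Q[y] and are triangular. *)

(** * Linear substitutions *)

Section Substitution.
Variables (R : comNzRingType) (n : nat).
Implicit Types (f g : {mpoly R[n]}) (h : 'I_n -> {mpoly R[n]}).

(** Constants and variables generate the polynomial algebra, so identities and congruences between
    substitutions need checking only on the variables. *)
Lemma mpoly_alg_ind (P : {mpoly R[n]} -> Prop) :
  (forall c, P c%:MP) -> (forall i, P 'X_i) ->
  (forall f g, P f -> P g -> P (f + g)) ->
  (forall f g, P f -> P g -> P (f * g)) -> forall f, P f.
Proof.
move=> PC PX PD PM; elim/mpolyind => [|c m f _ _ IHf]; first exact: (PC 0).
apply: (PD) => //; rewrite -mul_mpolyC; apply: (PM) => //.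
rewrite mpolyXE_id; apply: big_ind => //; first exact: (PC 1).
move=> i _; elim: (m i) => [|e IHe]; first by rewrite expr0; exact: (PC 1).
by rewrite exprS; exact: PM.
Qed.

Definition subst h : {mpoly R[n]} -> {mpoly R[n]} := comp_mpoly [tuple h r | r < n].

HB.instance Definition _ h := GRing.LRMorphism.copy (subst h)
  (comp_mpoly [tuple h r | r < n]).

Lemma substX h r : subst h 'X_r = h r.
Proof. by rewrite /subst comp_mpolyXU -tnth_nth tnth_mktuple. Qed.

Lemma substC h c : subst h c%:MP = c%:MP.
Proof. exact: comp_mpolyC. Qed.

Lemma subst_comp h h' f : subst h (subst h' f) = subst (fun r => subst h (h' r)) f.
Proof.
elim/mpoly_alg_ind: f => [c|i|f g IHf IHg|f g IHf IHg].
- by rewrite !substC.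
- by rewrite !substX.
- by rewrite !rmorphD /= IHf IHg.
- by rewrite !rmorphM /= IHf IHg.
Qed.

Lemma subst_id f : subst (fun r => 'X_r) f = f.
Proof. exact: comp_mpoly_id. Qed.

Lemma eq_subst h h' : h =1 h' -> subst h =1 subst h'.
Proof.
move=> eqh f; elim/mpoly_alg_ind: f => [c|i|f g IHf IHg|f g IHf IHg].
- by rewrite !substC.
- by rewrite !substX.
- by rewrite !rmorphD /= IHf IHg.
- by rewrite !rmorphM /= IHf IHg.
Qed.

Definition mdvd (f g : {mpoly R[n]}) := exists q, g = f * q.

Lemma mdvd_subst h f g : mdvd f g -> mdvd (subst h f) (subst h g).
Proof. by case=> q ->; exists (subst h q); rewrite rmorphM. Qed.

Lemma mdvdD f g g' : mdvd f g -> mdvd f g' -> mdvd f (g + g').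
Proof. by case=> q -> [q' ->]; exists (q + q'); rewrite mulrDr. Qed.

Lemma mdvdB f g g' : mdvd f g -> mdvd f g' -> mdvd f (g - g').
Proof. by case=> q -> [q' ->]; exists (q - q'); rewrite mulrBr. Qed.

Lemma mdvdMl f g g' : mdvd f g -> mdvd f (g' * g).
Proof. by case=> q ->; exists (g' * q); rewrite mulrCA. Qed.

Lemma mdvdMr f g g' : mdvd f g -> mdvd f (g * g').
Proof. by case=> q ->; exists (q * g'); rewrite mulrA. Qed.

Lemma mdvd0 f : mdvd f 0.
Proof. by exists 0; rewrite mulr0. Qed.

Lemma mdvd_sum (I : finType) (P : pred I) f (F : I -> {mpoly R[n]}) :
  (forall x, P x -> mdvd f (F x)) -> mdvd f (\sum_(x | P x) F x).
Proof.
by move=> dvdF; apply: big_ind => //; [exact: mdvd0 | move=> ? ?; exact: mdvdD].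
Qed.

(** Congruence modulo [f] respects sums and products. The lemma is used to compare the twists at the
    two ends of a GKM edge. *)
Lemma subst_congr h h' f : (forall r, mdvd f (h r - h' r)) ->
  forall g, mdvd f (subst h g - subst h' g).
Proof.
move=> hh' g; elim/mpoly_alg_ind: g => [c|i|g g' IHg IHg'|g g' IHg IHg'].
- by rewrite !substC subrr; exact: mdvd0.
- by rewrite !substX.
- by rewrite !rmorphD /= opprD addrACA; exact: mdvdD.
- have -> : subst h (g * g') - subst h' (g * g') =
    (subst h g - subst h' g) * subst h g' + subst h' g * (subst h g' - subst h' g').
    by rewrite !rmorphM /= mulrBl mulrBr addrA subrK.
  by apply: mdvdD; [exact: mdvdMr | exact: mdvdMl].
Qed.

Lemma subst_homog h d f : (forall r, h r \is 1.-homog) -> f \is d.-homog ->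
  subst h f \is d.-homog.
Proof.
move=> hom1 homf; rewrite /subst comp_mpolyEX big_seq; apply: rpred_sum => m mf.
rewrite rpredZ // comp_mpolyX.
have /= <- := dhomogP _ _ _ homf m mf; rewrite mdegE.
elim/big_ind2: _ => [|f1 d1 f2 d2|i _]; first exact: dhomog1.
  exact: dhomogM.
by have /= := dhomogMn (m i) (hom1 i); rewrite mul1n tnth_mktuple.
Qed.

Lemma prod_homog1 (I : finType) (A : pred I) (F : I -> {mpoly R[n]}) :
  (forall x, A x -> F x \is 1.-homog) -> \prod_(x | A x) F x \is #|A|.-homog.
Proof.
move=> homF; rewrite -sum1_card.
by elim/big_ind2: _ => [|f1 d1 f2 d2|]; [exact: dhomog1 | exact: dhomogM | exact: homF].
Qed.

(** The quotient by ['X_s - 'X_s'] realized inside the same polynomial ring. By the next two lemmas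
    the kernel of this substitution is the ideal of that form, so divisibility by it becomes a
    vanishing test. *)
Definition merge_var (s s' : 'I_n) (r : 'I_n) : {mpoly R[n]} :=
  if r == s then 'X_s' else 'X_r.

Lemma dvd_merge_var s s' f : mdvd ('X_s - 'X_s') (f - subst (merge_var s s') f).
Proof.
rewrite -{1}(subst_id f); apply: subst_congr => r; rewrite /merge_var.
case: eqP => [->|_]; first by exists 1; rewrite mulr1.
by rewrite subrr; exact: mdvd0.
Qed.

Lemma subst_merge_varE s s' : subst (merge_var s s') ('X_s - 'X_s') = 0.
Proof.
by rewrite rmorphB /= !substX /merge_var eqxx; case: eqP => _; rewrite subrr.
Qed.

End Substitution.

Lemma subst_merge_varB (n : nat) (s s' : 'I_n) (x y : 'I_n) :
  subst (merge_var rat s s') ('X_x - 'X_y) = merge_var rat s s' x - merge_var rat s s' y.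
Proof. by rewrite rmorphB /= !substX. Qed.

Lemma mpolyXB_neq0 (n : nat) (x y : 'I_n) :
  x != y -> ('X_x - 'X_y : {mpoly rat[n]}) != 0.
Proof.
move=> neqxy; apply/eqP => /(congr1 (meval (fun r => (r == x)%:R))).
rewrite mevalB !mevalXU meval0 eqxx eq_sym (negbTE neqxy) subr0 => /eqP.
by rewrite oner_eq0.
Qed.

(** * Divisibility by products of coprime linear forms *)

Section CoprimeForms.
Variables (n : nat) (A : {set 'I_n}).

(* Merging the two variables of one factor keeps the other factors nonzero,
   since a pair with x.1 outside A and x.2 inside A cannot occur reversed. *)
Lemma prod_merge_var_neq0 (P : pred ('I_n * 'I_n)) (s s' : 'I_n) :
  s \notin A -> s' \in A -> {subset P <= [pred x | (x.1 \notin A) && (x.2 \in A)]} ->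
  ~~ P (s, s') ->
  \prod_(x | P x) subst (merge_var rat s s') ('X_x.1 - 'X_x.2) != 0.
Proof.
move=> sA s'A PA nP; apply/prodf_neq0 => -[a c] Pac /=.
rewrite subst_merge_varB /merge_var.
have /andP[/= aA cA] := PA _ Pac.
have -> : (c == s) = false by apply: contraNF sA => /eqP <-.
case: (a =P s) => [eas|_]; apply: mpolyXB_neq0; last first.
  by apply: contraNneq aA => ->.
by apply: contraNneq nP => es'; rewrite es' -eas.
Qed.

(** Induction on the number of pairs. Write [f] as the product of the other forms times [q]; merging
    the variables of [x0] kills [f] but not that product, hence it kills [q]. *)
Lemma dvd_prod_pairs (f : {mpoly rat[n]}) (P : pred ('I_n * 'I_n)) :
  {subset P <= [pred x | (x.1 \notin A) && (x.2 \in A)]} ->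
  (forall x, P x -> mdvd ('X_x.1 - 'X_x.2) f) ->
  mdvd (\prod_(x | P x) ('X_x.1 - 'X_x.2)) f.
Proof.
have [N] := ubnP #|P|; elim: N P => // N IHN P ltPN PA dvdf.
have [x0 Px0|P0] := pickP P; last first.
  by rewrite big_pred0 //; exists f; rewrite mul1r.
have [] := IHN [pred x | P x && (x != x0)].
- apply: leq_trans (ltPN : (#|P| <= N)%N); apply/proper_card/properP; split.
    by apply/subsetP => x /andP[].
  by exists x0; rewrite // unfold_in /= eqxx andbF.
- by move=> x /andP[/PA].
- by move=> x /andP[/dvdf].
move=> q def_f; rewrite (bigD1 x0) //=.
have /andP[x0A x0A'] := PA _ Px0.
suff [q' def_q] : mdvd ('X_x0.1 - 'X_x0.2) q.
  by exists q'; rewrite def_f def_q mulrCA mulrA.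
have := dvd_merge_var x0.1 x0.2 q; suff -> : subst (merge_var rat x0.1 x0.2) q = 0.
  by rewrite subr0.
have [g def_f'] := dvdf _ Px0.
have := congr1 (subst (merge_var rat x0.1 x0.2)) (etrans (esym def_f) def_f').
rewrite rmorphM rmorph_prod [in RHS]rmorphM /= subst_merge_varE mul0r => /eqP.
rewrite mulf_eq0 => /orP[|/eqP //].
apply: contraTeq => _; apply: prod_merge_var_neq0 => //; last first.
  by rewrite -surjective_pairing eqxx andbF.
by move=> x /andP[/PA].
Qed.

End CoprimeForms.

(** * Schubert symbols *)

Lemma ltn_sum (I : finType) (P : pred I) (E F : I -> nat) i0 :
  P i0 -> (forall i, P i -> (E i <= F i)%N) -> (E i0 < F i0)%N ->
  (\sum_(i | P i) E i < \sum_(i | P i) F i)%N.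
Proof.
move=> Pi0 leEF ltEF; rewrite (bigD1 i0) //= [ltnRHS](bigD1 i0) //= -addSn leq_add //.
by apply: leq_sum => i /andP[/leEF].
Qed.

Lemma widen_ord_inj p q (le_pq : (p <= q)%N) : injective (widen_ord le_pq).
Proof. by move=> r s /(congr1 (@nat_of_ord q)) eq_rs; apply/val_inj. Qed.

Section Symbols.
Variables n k : nat.
Implicit Types a c : symbol n k.

Lemma symbol_ltn a (r s : 'I_k) : (r < s)%N -> (a r < a s)%N.
Proof. by case: a => f inc_f /= lt_rs; move/forallP/(_ r)/forallP/(_ s)/implyP: inc_f; apply. Qed.

Lemma symbol_inj a : injective a.
Proof.
move=> r s eq_rs; apply/val_inj; case: (ltngtP r s) => // /(symbol_ltn a);
by rewrite eq_rs ltnn.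
Qed.

Lemma symbol_geq_id a (r : 'I_k) : (r <= a r)%N.
Proof.
case: r => r; elim: r => // r IHr ltr.
exact: leq_ltn_trans (IHr (ltnW ltr)) (symbol_ltn a (_ : (Ordinal (ltnW ltr) < Ordinal ltr)%N)).
Qed.

Lemma symbol_sset a r : a r \in sset a.
Proof. exact: imset_f. Qed.

Lemma card_sset a : #|sset a| = k.
Proof. by rewrite card_imset ?card_ord //; exact: symbol_inj. Qed.

(** The values of a symbol are the strictly increasing enumeration of its set, and such an
    enumeration is unique. *)
Lemma sset_inj : injective (@sset n k).
Proof.
move=> a c eq_ac; apply/val_inj/ffunP => r.
have sorted_vals (d : symbol n k) : sorted ltn [seq val (d i) | i <- enum 'I_k].
  rewrite sorted_map; apply: (@sub_sorted _ (fun i j : 'I_k => (i < j)%N)).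
    exact: symbol_ltn.
  by have := iota_ltn_sorted 0 k; rewrite -val_enum_ord sorted_map.
have: [seq val (a i) | i <- enum 'I_k] = [seq val (c i) | i <- enum 'I_k].
  apply: (irr_sorted_eq ltn_trans ltnn) => // x.
  have mem_vals (d : symbol n k) :
      (x \in [seq val (d i) | i <- enum 'I_k]) = (x \in [seq val y | y in sset d]).
    apply/mapP/imageP => [[i _ ->]|[y /imsetP[i _ ->] ->]].
      by exists (d i); rewrite ?symbol_sset.
    by exists i; rewrite ?mem_enum.
  by rewrite !mem_vals eq_ac.
by move/eq_in_map/(_ r)/(_ (mem_enum _ r))/val_inj.
Qed.

Lemma big_sset (V : nmodType) (f : 'I_n -> V) a :
  \sum_(r < k) f (a r) = \sum_(x in sset a) f x.
Proof. by rewrite big_imset //= => r s _ _; exact: symbol_inj. Qed.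

Lemma sle_refl a : sle a a.
Proof. exact/forallP. Qed.

Lemma sle_trans a c d : sle a c -> sle c d -> sle a d.
Proof.
move=> /forallP ac /forallP cd; apply/forallP => r.
exact: leq_trans (ac r) (cd r).
Qed.

Lemma sle_sdim a c : sle a c -> (sdim a <= sdim c)%N.
Proof. by move=> /forallP ac; apply: leq_sum => r _; rewrite leq_sub2r. Qed.

Lemma slt_sdim a c : sle a c -> a != c -> (sdim a < sdim c)%N.
Proof.
move=> /forallP ac neq_ac; have [r lt_r] : exists r, (a r < c r)%N.
  apply/existsP; apply: contraR neq_ac => /existsPn nlt.
  apply/eqP/val_inj/ffunP => r; apply/val_inj/eqP.
  by rewrite eqn_leq ac leqNgt nlt.
apply: (@ltn_sum _ _ _ _ r) => // [t _|]; first by rewrite leq_sub2r.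
(* The bound [r <= a r] makes the truncated subtraction exact, so strictness survives. *)
by have := symbol_geq_id a r; lia.
Qed.

(** All entries grow weakly and their sum grows by one, so a single entry grows, and by one. *)
Lemma scover_step a c : scover c a -> exists s s' : 'I_n,
  [/\ s' = s.+1 :> nat, s \in sset a, s' \notin sset a &
      sset c = s' |: (sset a :\ s)].
Proof.
case/andP => /forallP ac /eqP dim_c.
have neq_ac : a != c by apply: contra_eq_neq dim_c => ->; rewrite -addn1; lia.
have [r lt_r] : exists r, (a r < c r)%N.
  apply/existsP; apply: contraR neq_ac => /existsPn nlt.
  apply/eqP/val_inj/ffunP => r; apply/val_inj/eqP.
  by rewrite eqn_leq ac leqNgt nlt.
have dim_split d : sdim d = (d r - r + \sum_(i < k | i != r) (d i - i))%N.
  by rewrite /sdim (bigD1 r).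
have le_rest : (\sum_(i < k | i != r) (a i - i) <= \sum_(i < k | i != r) (c i - i))%N.
  by apply: leq_sum => t _; rewrite leq_sub2r.
have rle := symbol_geq_id a r.
have cr : c r = (a r).+1 :> nat by rewrite !dim_split in dim_c; lia.
have eq_rest t : t != r -> a t = c t.
  move=> ntr; apply/val_inj/eqP; rewrite eqn_leq ac leqNgt /=; apply/negP => lt_t.
  have : (\sum_(i < k | i != r) (a i - i) < \sum_(i < k | i != r) (c i - i))%N.
    apply: (@ltn_sum _ _ _ _ t) => // [u _|]; first by rewrite leq_sub2r.
    by have := symbol_geq_id a t; lia.
  by rewrite !dim_split in dim_c; lia.
exists (a r), (c r); split => //; first exact: symbol_sset.
  apply/imsetP => -[t _ eq_t]; case: (eqVneq t r) => [etr|ntr].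
    by move: lt_r; rewrite eq_t etr ltnn.
  by have/symbol_inj etr := etrans eq_t (eq_rest t ntr); rewrite etr eqxx in ntr.
apply/setP => x; rewrite !inE; apply/imsetP/idP => [[t _ ->]|].
  case: (eqVneq t r) => [->|ntr]; first by rewrite eqxx.
  by rewrite -eq_rest // symbol_sset (inj_eq (@symbol_inj a)) ntr orbT.
case/orP => [/eqP -> | /andP[nx /imsetP[t _ ext]]]; first by exists r.
by exists t => //; rewrite ext eq_rest //; apply: contraNneq nx => <-; rewrite ext.
Qed.

Definition below (A : {set 'I_n}) (x : nat) : {set 'I_n} := [set y in A | (y < x)%N].

(** If [c r < a r], then [c] has at least [r + 1] entries up to [c r], while [a] has at most [r] of
    them. *)
Lemma sle_below a c :
  (forall x, #|below (sset c) x| <= #|below (sset a) x|)%N -> sle a c.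
Proof.
move=> le_below; apply/forallP => r; rewrite leqNgt; apply/negP => lt_r.
have lower : (r.+1 <= #|below (sset c) (c r).+1|)%N.
  rewrite -[r.+1]card_ord.
  rewrite -(card_imset _ (inj_comp (@symbol_inj c) (@widen_ord_inj _ _ (ltn_ord r)))).
  apply/subset_leq_card/subsetP => x /imsetP[t _ ->] /=.
  rewrite inE symbol_sset ltnS leq_eqVlt /=.
  have : (t <= r)%N by rewrite -ltnS.
  rewrite leq_eqVlt => /orP[/eqP etr|lt_tr]; apply/orP; last by right; exact: symbol_ltn.
  by left; apply/eqP; congr (nat_of_ord (c _)); apply/val_inj.
have upper : (#|below (sset a) (c r).+1| <= r)%N.
  have widen_le : (r <= k)%N by exact: ltnW.
  rewrite -[X in (_ <= X)%N](card_ord r).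
  rewrite -(card_imset _ (inj_comp (@symbol_inj a) (@widen_ord_inj _ _ widen_le))).
  apply/subset_leq_card/subsetP => x; rewrite inE => /andP[/imsetP[t _ ->] le_t].
  have lt_tr : (t < r)%N.
    rewrite ltnNge leq_eqVlt; apply/negP => /orP[/eqP ert|/(symbol_ltn a)].
      by move: le_t; rewrite -(_ : r = t); [lia | apply/val_inj].
    lia.
  by apply/imsetP; exists (Ordinal lt_tr) => //=; congr (a _); apply/val_inj.
by have := leq_trans (leq_trans lower (le_below _)) upper; rewrite ltnn.
Qed.

Lemma Iset_sle a c : c \in Iset a -> sle a c && (a != c).
Proof.
rewrite inE => /existsP[s /existsP[s' /and4P[sa s'a lt_s /eqP def_c]]].
apply/andP; split; last first.
  apply: contraNneq s'a => ->; by rewrite def_c !inE eqxx.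
(* Up to the threshold [s'] only the loss of [s] can matter; beyond it both [s] and [s'] are counted
   and the two counts agree. *)
apply: sle_below => x; have [le_x|lt_x] := leqP x s'.
  apply/subset_leq_card/subsetP => y; rewrite !inE def_c !inE.
  by case/andP => /orP[/eqP ->|/andP[_ ->] ->] //; rewrite ltnNge le_x.
have -> : below (sset c) x = s' |: (below (sset a) x :\ s).
  apply/setP => y; rewrite !inE def_c !inE andbA.
  by case: (y =P s') => [->|_] //=; rewrite lt_x.
have sx : s \in below (sset a) x by rewrite inE sa (ltn_trans lt_s lt_x).
by rewrite cardsU1 (cardsD1 s (below (sset a) x)) sx leq_add2r leq_b1.
Qed.

End Symbols.

(** * GKM families with rational coefficients *)

Lemma homog_msizeE (R : nzRingType) n d (f : {mpoly R[n]}) :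
  f != 0 -> f \is d.-homog -> msize f = d.+1.
Proof.
move=> f0 homf; have /(dhomog_uniq f0 homf) -> := dhomog_msize homf.
by rewrite prednK // lt0n msize_poly_eq0.
Qed.

(** Sizes are additive over a domain, so nothing is asked of the cofactor [g]. *)
Lemma homogM_leq n d e (f g h : {mpoly rat[n]}) : h != 0 ->
  h = f * g -> f \is e.-homog -> h \is d.-homog -> (e <= d)%N.
Proof.
move=> h0 def_h homf homh; have := h0; rewrite def_h mulf_eq0 negb_or => /andP[f0 g0].
have := msizeM f0 g0; rewrite -def_h (homog_msizeE h0 homh) (homog_msizeE f0 homf).
rewrite addSn /= => [eq_d]; rewrite -ltnS eq_d -addn1 leq_add2l.
by rewrite lt0n msize_poly_eq0.
Qed.

Section Exchange.
Variable n : nat.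
Implicit Types (A : {set 'I_n}) (x y : 'I_n * 'I_n).

(** These pairs index the edges from a vertex down to its [Rset]: the entry [x.2] is replaced by the
    smaller [x.1], and the unweighted root of the edge is ['X_x.1 - 'X_x.2]. *)
Definition exch_pair A : pred ('I_n * 'I_n) :=
  fun x => [&& x.1 \notin A, x.2 \in A & (x.1 < x.2)%N].

Definition exchange A x : {set 'I_n} := x.1 |: (A :\ x.2).

Lemma card_exchange A x : exch_pair A x -> #|exchange A x| = #|A|.
Proof.
case/and3P => x1 x2 _.
by rewrite cardsU1 !inE (negbTE x1) andbF (cardsD1 x.2 A) x2.
Qed.

Lemma exchange_inj A : {in exch_pair A &, injective (exchange A)}.
Proof.
move=> [a c] [a' c'] /and3P[/= a_A c_A lt_ac] /and3P[/= a'_A c'_A lt_ac'].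
rewrite /exchange /= => /setP eq_ex.
have ea : a = a'.
  by have := eq_ex a; rewrite !inE eqxx (negbTE a_A) !andbF !orbF => /esym/idP/eqP.
suff ec : c = c' by rewrite ea ec.
have := eq_ex c.
have nca : (c == a) = false by apply: contraTF lt_ac => /eqP ->; rewrite ltnn.
by rewrite !inE -ea nca eqxx c_A /= andbT => /esym/negbFE/eqP.
Qed.

Lemma sum_exchange (V : zmodType) (f : 'I_n -> V) A x : exch_pair A x ->
  \sum_(r in exchange A x) f r = \sum_(r in A) f r + (f x.1 - f x.2).
Proof.
case/and3P => x1 x2 _.
rewrite big_setU1 ?inE ?(negbTE x1) ?andbF //= (big_setD1 _ x2) /=.
by rewrite [f x.2 + _]addrC [f x.1 - _]addrC addrA addrK addrC.
Qed.

End Exchange.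

Section Vertices.
Variables (n k m : nat) (lam : 'I_m.+1 -> symbol n k).
Hypothesis m_bin : m.+1 = 'C(n, k).
Hypothesis lam_bij : bijective lam.
Hypothesis lam_mono : forall i j, sle (lam i) (lam j) -> (i <= j)%N.

Local Notation A_ p := (sset (lam p)).

(** The default [ord0] is not reached when [A] has [k] elements, as the next lemma shows. *)
Definition vertex (A : {set 'I_n}) : 'I_m.+1 :=
  odflt ord0 [pick i | sset (lam i) == A].

(** By counting: an injective family of ['C(n, k)] subsets of size [k] exhausts all of them. *)
Lemma sset_vertex (A : {set 'I_n}) : #|A| = k -> sset (lam (vertex A)) = A.
Proof.
move=> cardA; rewrite /vertex; case: pickP => [i /eqP //|noA].
have A_inj : injective (fun i => A_ i) := inj_comp (@sset_inj n k) (bij_inj lam_bij).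
suff /imsetP[i _ defA] : A \in [set A_ i | i : 'I_m.+1].
  by have := noA i; rewrite  -defA eqxx.
suff -> : [set A_ i | i : 'I_m.+1] = [set B : {set 'I_n} | #|B| == k] by rewrite inE cardA.
apply/eqP; rewrite eqEcard; apply/andP; split.
  by apply/subsetP => _ /imsetP[i _ ->]; rewrite inE card_sset.
by rewrite card_imset // card_ord card_draws card_ord m_bin.
Qed.

Lemma lam_inj : injective lam. Proof. exact: bij_inj. Qed.

Definition Rindex p : {set 'I_m.+1} := [set l | lam l \in Rset (lam p)].

Lemma Rset_lt (l p : 'I_m.+1) : l \in Rindex p -> (l < p)%N.
Proof.
rewrite !inE => inI.
have /andP[le_lp neq_lp] : sle (lam l) (lam p) && (lam l != lam p).
  by apply: Iset_sle; rewrite inE.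
rewrite ltn_neqAle (lam_mono le_lp) andbT.
by apply: contraNneq neq_lp => /val_inj ->.
Qed.

Lemma Rset_sle l p : l \in Rindex p -> sle (lam l) (lam p).
Proof. by rewrite inE inE => /Iset_sle/andP[]. Qed.

Lemma Rindex_exchange p : Rindex p = [set vertex (exchange (A_ p) x) | x in exch_pair (A_ p)].
Proof.
have vK x : x \in exch_pair (A_ p) ->
    sset (lam (vertex (exchange (A_ p) x))) = exchange (A_ p) x.
  by move=> inv_x; rewrite sset_vertex // card_exchange // card_sset.
apply/setP => l; rewrite !inE; apply/existsP/imsetP => [[s]|[[s s'] inv_s ->]].
  case/existsP => s' /and4P[sl s'l lt_ss /eqP def_p].
  have neq_ss : s != s' by apply: contraTneq lt_ss => ->; rewrite ltnn.
  have inv_s : (s, s') \in exch_pair (A_ p).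
    by rewrite unfold_in /exch_pair /= def_p !inE !eqxx lt_ss (negbTE neq_ss).
  exists (s, s') => //; apply/lam_inj/sset_inj; rewrite vK //.
  apply/setP => x; rewrite /exchange def_p !inE /=.
  case: (eqVneq x s) => [->|_] //=; case: (eqVneq x s') => [->|] //=.
  by rewrite (negbTE s'l).
have /and3P[/= s_p s'_p lt_ss] := inv_s.
have neq_ss : s != s' by apply: contraTneq lt_ss => ->; rewrite ltnn.
exists s; apply/existsP; exists s'; rewrite vK // /exchange !inE eqxx /= lt_ss.
rewrite eq_sym (negbTE neq_ss) /= eqxx /=; apply/eqP/setP => x; rewrite !inE.
case: (eqVneq x s') => [->|] /=; first by rewrite s'_p.
by case: (eqVneq x s) => [->|] //= _; rewrite (negbTE s_p).
Qed.

Lemma vertex_exchange p x : exch_pair (A_ p) x ->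
  sset (lam (vertex (exchange (A_ p) x))) = exchange (A_ p) x.
Proof. by move=> inv_x; rewrite sset_vertex // card_exchange // card_sset. Qed.

Lemma prod_Rindex (T : comNzRingType) (G : 'I_m.+1 -> T) p :
  \prod_(l in Rindex p) G l =
  \prod_(x | exch_pair (A_ p) x) G (vertex (exchange (A_ p) x)).
Proof.
rewrite Rindex_exchange big_imset //= => x y inv_x inv_y eq_xy.
apply: (exchange_inj inv_x inv_y).
by rewrite -(vertex_exchange inv_x) -(vertex_exchange inv_y) eq_xy.
Qed.

Definition Ysym_rat (p : 'I_m.+1) : {mpoly rat[n]} := \sum_(r < k) 'X_(lam p r).

Lemma Ysym_rat_sset p : Ysym_rat p = \sum_(r in A_ p) 'X_r.
Proof. exact: big_sset. Qed.

Lemma Ysym_rat_exchange p x : exch_pair (A_ p) x ->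
  Ysym_rat (vertex (exchange (A_ p) x)) - Ysym_rat p = 'X_x.1 - 'X_x.2.
Proof.
by move=> inv_x; rewrite !Ysym_rat_sset vertex_exchange // sum_exchange // addrAC subrr add0r.
Qed.

Lemma Ysym_rat_homog p : Ysym_rat p \is 1.-homog.
Proof. by apply: rpred_sum => r _; rewrite dhomogX /= mdeg1. Qed.

(** * Weighted roots and the twist at a vertex *)

Section Weights.
Variables (B : 'I_m.+1 -> rat) (e : 'I_n -> rat).
Hypothesis B_neq0 : forall p, B p != 0.
Hypothesis B_lin : forall p, B p = 1 + \sum_(r < k) e (lam p r).

Definition twist (p : 'I_m.+1) : {mpoly rat[n]} -> {mpoly rat[n]} :=
  subst (fun r => 'X_r - (e r / B p) *: Ysym_rat p).

HB.instance Definition _ p := GRing.LRMorphism.copy (twist p)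
  (subst (fun r => 'X_r - (e r / B p) *: Ysym_rat p)).

(** Since [twist p] divides [Ysym_rat p] by [B p], its inverse needs no denominator. *)
Definition twist_inv (p : 'I_m.+1) : {mpoly rat[n]} -> {mpoly rat[n]} :=
  subst (fun r => 'X_r + e r *: Ysym_rat p).

HB.instance Definition _ p := GRing.LRMorphism.copy (twist_inv p)
  (subst (fun r => 'X_r + e r *: Ysym_rat p)).

Lemma twistX p r : twist p 'X_r = 'X_r - (e r / B p) *: Ysym_rat p.
Proof. exact: substX. Qed.

Lemma twist_invX p r : twist_inv p 'X_r = 'X_r + e r *: Ysym_rat p.
Proof. exact: substX. Qed.

Lemma twist_Ysym p l : twist p (Ysym_rat l) = Ysym_rat l - ((B l - 1) / B p) *: Ysym_rat p.
Proof.
rewrite /Ysym_rat [LHS]rmorph_sum /=.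
under eq_bigr => r _ do rewrite twistX.
rewrite sumrB -/(Ysym_rat l) -scaler_suml; congr (_ - _ *: _).
by rewrite -mulr_suml (B_lin l) [1 + _]addrC addrK.
Qed.

Lemma twist_inv_Ysym p l : twist_inv p (Ysym_rat l) = Ysym_rat l + (B l - 1) *: Ysym_rat p.
Proof.
rewrite /Ysym_rat [LHS]rmorph_sum /=.
under eq_bigr => r _ do rewrite twist_invX.
by rewrite big_split /= -/(Ysym_rat l) -scaler_suml (B_lin l) [1 + _]addrC addrK.
Qed.

Lemma twistK p : cancel (twist p) (twist_inv p).
Proof.
move=> f; rewrite /twist_inv /twist subst_comp -[RHS]subst_id; apply: eq_subst => r.
rewrite rmorphB /= linearZ /= substX -/(twist_inv p _) twist_inv_Ysym.
rewrite -[X in _ *: (X + _)]scale1r -scalerDl [1 + _]addrC subrK scalerA.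
by rewrite divfK // addrK.
Qed.

Lemma twist_invK p : cancel (twist_inv p) (twist p).
Proof.
move=> f; rewrite /twist_inv /twist subst_comp -[RHS]subst_id; apply: eq_subst => r.
rewrite rmorphD /= linearZ /= substX -/(twist p _) twist_Ysym.
rewrite -[X in _ *: (X - _)]scale1r -scalerBl scalerA -addrA -scaleNr -scalerDl.
suff -> : - (e r / B p) + e r * (1 - (B p - 1) / B p) = 0 by rewrite scale0r addr0.
by field.
Qed.

Definition wroot_rat l p := Ysym_rat l - (B l / B p) *: Ysym_rat p.

(** The twist subtracts [(B l - B p) / B p] times [Ysym_rat p], and the part coming from [B p]
    cancels the original [- Ysym_rat p]. *)
Lemma twist_root p l : twist p (Ysym_rat l - Ysym_rat p) = wroot_rat l p.
Proof.
rewrite rmorphB /= !twist_Ysym /wroot_rat opprB addrACA -addrA; congr (_ + _).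
rewrite addrC -addrA -!scaleNr.
rewrite -[X in - X + _]scale1r -scaleNr -!scalerDl; congr (_ *: _).
by field.
Qed.

Definition gkm_rat (F : 'I_m.+1 -> {mpoly rat[n]}) :=
  forall l p, l \in Rindex p -> mdvd (wroot_rat l p) (F p - F l).

Lemma prod_wroot_rat p : \prod_(l in Rindex p) wroot_rat l p =
  twist p (\prod_(x | exch_pair (A_ p) x) ('X_x.1 - 'X_x.2)).
Proof.
rewrite prod_Rindex rmorph_prod /=; apply: eq_bigr => x inv_x.
by rewrite -twist_root (Ysym_rat_exchange inv_x).
Qed.

(** The automorphism [twist p] carries the differences of variables to the weighted roots at [p], so
    their coprimality is transported. *)
Lemma dvd_prod_wroot_rat p (f : {mpoly rat[n]}) :
  (forall l, l \in Rindex p -> mdvd (wroot_rat l p) f) ->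
  mdvd (\prod_(l in Rindex p) wroot_rat l p) f.
Proof.
move=> dvdf; rewrite prod_wroot_rat -[f](twist_invK p); apply: mdvd_subst.
apply: (@dvd_prod_pairs _ (A_ p)) => [x /and3P[x1 x2 _]|x inv_x].
  by rewrite inE x1.
rewrite -(Ysym_rat_exchange inv_x) -[Ysym_rat _ - _](twistK p) twist_root; apply/mdvd_subst/dvdf.
by rewrite Rindex_exchange; apply: imset_f.
Qed.

Lemma prod_wroot_rat_neq0 p : \prod_(l in Rindex p) wroot_rat l p != 0.
Proof.
set f := \prod_(x | exch_pair (A_ p) x) ('X_x.1 - 'X_x.2 : {mpoly rat[n]}).
have nz_f : f != 0.
  apply/prodf_neq0 => x /and3P[_ _ lt_x]; apply: mpolyXB_neq0.
  by apply: contraTneq lt_x => ->; rewrite ltnn.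
rewrite prod_wroot_rat -/f; apply: contraNneq nz_f => psi_f.
by rewrite -[f](twistK p) psi_f rmorph0.
Qed.

Lemma prod_wroot_rat_homog p : \prod_(l in Rindex p) wroot_rat l p \is #|Rindex p|.-homog.
Proof.
apply: prod_homog1 => l _; apply: rpredB; last apply: rpredZ; exact: Ysym_rat_homog.
Qed.

Definition schubert_family (F : 'I_m.+1 -> 'I_m.+1 -> {mpoly rat[n]}) :=
  [/\ forall i, gkm_rat (F i),
      forall i p, ~~ sle (lam i) (lam p) -> F i p = 0,
      forall i, F i i = \prod_(l in Rindex i) wroot_rat l i
    & forall i p, F i p \is (sdim (lam i)).-homog].

Lemma gkm_rat_const f : gkm_rat (fun=> f).
Proof. by move=> l p _; rewrite subrr; exact: mdvd0. Qed.

Lemma gkm_ratM F G : gkm_rat F -> gkm_rat G -> gkm_rat (fun p => F p * G p).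
Proof.
move=> gF gG l p lp.
have -> : F p * G p - F l * G l = (F p - F l) * G p + F l * (G p - G l).
  by rewrite mulrBl mulrBr addrA subrK.
by apply: mdvdD; [apply/mdvdMr/gF | apply/mdvdMl/gG].
Qed.

Lemma gkm_ratB F G : gkm_rat F -> gkm_rat G -> gkm_rat (fun p => F p - G p).
Proof.
move=> gF gG l p lp.
have -> : F p - G p - (F l - G l) = (F p - F l) - (G p - G l).
  by rewrite !opprB addrACA [RHS]addrACA [- G p + _]addrC.
by apply: mdvdB; [apply/gF | apply/gG].
Qed.

Lemma gkm_rat_sum (P : pred 'I_m.+1) (F : 'I_m.+1 -> 'I_m.+1 -> {mpoly rat[n]}) :
  (forall i, P i -> gkm_rat (F i)) -> gkm_rat (fun p => \sum_(i | P i) F i p).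
Proof.
by move=> gF l p lp; rewrite -sumrB; apply: mdvd_sum => i Pi; apply: gF.
Qed.

(** * Schubert classes as a triangular basis *)

Section Class.
Variable F : 'I_m.+1 -> 'I_m.+1 -> {mpoly rat[n]}.
Hypothesis clF : schubert_family F.

(* Read off the degree of the diagonal value of a Schubert class. *)
Lemma card_Rindex p : #|Rindex p| = sdim (lam p).
Proof.
have [_ _ diag hom] := clF.
apply: (@dhomog_uniq _ _ _ _ _ _ (prod_wroot_rat_neq0 p)); first exact: prod_wroot_rat_homog.
by rewrite -diag.
Qed.

(** The neighbours of [p] in [Rindex p] come earlier in the order, so [al] vanishes there and each
    root at [p] divides [al p]. *)
Lemma gkm_rat_dvd_prod al (p : 'I_m.+1) :
  gkm_rat al -> (forall l : 'I_m.+1, (l < p)%N -> al l = 0) ->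
  mdvd (\prod_(l in Rindex p) wroot_rat l p) (al p).
Proof.
move=> g_al al0; apply: dvd_prod_wroot_rat => l lp.
by have := g_al l p lp; rewrite (al0 l (Rset_lt lp)) subr0.
Qed.

(** This is the uniqueness principle for Schubert classes. At a first vertex with a nonzero value,
    of dimension above [d], that value would be divisible by a product of more than [d] roots. *)
Lemma homog_class_eq0 al d : gkm_rat al -> (forall p, al p \is d.-homog) ->
  (forall p, (sdim (lam p) <= d)%N -> al p = 0) -> forall p, al p = 0.
Proof.
move=> g_al hom_al al0 p.
have [N] := ubnP (val p); elim: N p => // N IHN p lt_pN.
have [//|lt_d] := leqP (sdim (lam p)) d; first exact: al0.
apply/eqP; apply: contraLR lt_d => al_p; rewrite -leqNgt -card_Rindex.
have [l lt_lp|g def_al] := @gkm_rat_dvd_prod al p g_al.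
  by apply: IHN; apply: leq_trans lt_lp _.
exact: homogM_leq al_p def_al (prod_wroot_rat_homog p) (hom_al p).
Qed.

Lemma class_diag_neq0 p : F p p != 0.
Proof. by have [_ _ -> _] := clF; exact: prod_wroot_rat_neq0. Qed.

Lemma class_lt (l p : 'I_m.+1) : (p < l)%N -> F l p = 0.
Proof.
have [_ supp _ _] := clF; move=> lt_pl; apply: supp.
by apply: contraL lt_pl => /lam_mono; rewrite -leqNgt.
Qed.

Lemma class_expansion al : gkm_rat al ->
  exists a : 'I_m.+1 -> {mpoly rat[n]}, forall p, al p = \sum_l a l * F l p.
Proof.
have [gF _ diag _] := clF.
(* [N] is the number of final vertices at which [al] may still be nonzero. *)
suff expand N : (N <= m.+1)%N -> forall al, gkm_rat al ->
    (forall p : 'I_m.+1, (p < m.+1 - N)%N -> al p = 0) ->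
    exists a : 'I_m.+1 -> {mpoly rat[n]}, forall p, al p = \sum_l a l * F l p.
  by move=> g_al; apply: (expand m.+1) => // p; rewrite subnn.
elim: N => [_|N IHN ltN] {}al g_al al0.
  exists (fun=> 0) => p; rewrite big1 => [|l _]; last by rewrite mul0r.
  by apply: al0; rewrite subn0.
have lt_q : (m.+1 - N.+1 < m.+1)%N by lia.
(* At the first of these vertices [al] is a multiple of the diagonal value of [F q]; subtracting
   that multiple of the class clears [q] and leaves the earlier zeros alone. *)
pose q := Ordinal lt_q; have [g def_g] := gkm_rat_dvd_prod g_al (p := q) al0.
have g_al' : gkm_rat (fun p => al p - g * F q p).
  by apply: gkm_ratB => //; apply: gkm_ratM; [exact: gkm_rat_const | exact: gF].
have al'0 (p : 'I_m.+1) : (p < m.+1 - N)%N -> al p - g * F q p = 0.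
  move=> lt_p; have [lt_pq|lt_qp|eq_pq] := ltngtP p q.
  - by rewrite al0 // class_lt // mulr0 subrr.
  - by move: lt_p lt_qp => /=; lia.
  - by rewrite (val_inj eq_pq : p = q) def_g diag mulrC subrr.
have [a def_a] := IHN (ltnW ltN) _ g_al' al'0.
exists (fun l => a l + (l == q)%:R * g) => p.
under eq_bigr => l _ do rewrite mulrDl -mulrA.
rewrite big_split /= -def_a (bigD1 q) //= eqxx mul1r big1 ?addr0 ?subrK //.
by move=> l /negbTE ->; rewrite mul0r.
Qed.

Lemma class_free (a : 'I_m.+1 -> {mpoly rat[n]}) :
  (forall p, \sum_l a l * F l p = 0) -> forall l, a l = 0.
Proof.
move=> sum0 p; have [N] := ubnP (val p); elim: N p => // N IHN p lt_pN.
have := sum0 p; rewrite (bigD1 p) //= big1 ?addr0 => [/eqP|l neq_lp].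
  by rewrite mulf_eq0 (negbTE (class_diag_neq0 p)) orbF => /eqP.
have [lt_lp|lt_pl|/val_inj eq_lp] := ltngtP l p.
- by rewrite IHN ?mul0r //; apply: leq_trans lt_lp _.
- by rewrite class_lt ?mulr0.
- by rewrite eq_lp eqxx in neq_lp.
Qed.

(* [v] is the coordinate vector of [al] in the basis [F] modulo the ideal
   generated by the variables. *)
Definition rep (al : 'I_m.+1 -> {mpoly rat[n]}) (v : 'I_m.+1 -> rat) :=
  exists a : 'I_m.+1 -> {mpoly rat[n]},
    (forall p, al p = \sum_l a l * F l p) /\ forall l, (a l).@[fun=> 0] = v l.

Lemma rep_fun al v w : rep al v -> rep al w -> v =1 w.
Proof.
move=> [a [def_a va]] [c [def_c vc]] l; rewrite -va -vc; congr meval.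
apply/eqP; rewrite -subr_eq0; apply/eqP.
apply: (class_free (a := fun l => a l - c l)) => p.
under eq_bigr => i _ do rewrite mulrBl.
by rewrite sumrB -def_a -def_c subrr.
Qed.

Lemma eq_rep al al' v v' : al =1 al' -> v =1 v' -> rep al v -> rep al' v'.
Proof.
move=> eq_al eq_v [a [def_a va]]; exists a; split=> [p|l]; first by rewrite -eq_al.
by rewrite va.
Qed.

Lemma rep_sum (I : finType) (P : pred I) (al : I -> 'I_m.+1 -> {mpoly rat[n]}) v :
  (forall i, P i -> rep (al i) (v i)) ->
  rep (fun p => \sum_(i | P i) al i p) (fun l => \sum_(i | P i) v i l).
Proof.
move=> rep_al.
have rep_al' i : exists a : 'I_m.+1 -> {mpoly rat[n]}, P i ->
    (forall p, al i p = \sum_l a l * F l p) /\ forall l, (a l).@[fun=> 0] = v i l.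
  have [Pi|_] := boolP (P i); last by exists (fun=> 0).
  by have [a Ha] := rep_al i Pi; exists a.
have [a Ha] := boolp.choice rep_al'.
exists (fun l => \sum_(i | P i) a i l); split=> [p|l]; last first.
  by rewrite rmorph_sum /=; apply: eq_bigr => i Pi; have [_ ->] := Ha i Pi.
under [RHS]eq_bigr => l _ do rewrite mulr_suml.
by rewrite exchange_big /=; apply: eq_bigr => i Pi; have [->] := Ha i Pi.
Qed.

Lemma repM f al v : rep al v -> rep (fun p => f * al p) (fun l => f.@[fun=> 0] * v l).
Proof.
case=> a [def_a va]; exists (fun l => f * a l); split=> [p|l].
  by rewrite def_a mulr_sumr; apply: eq_bigr => l _; rewrite mulrA.
by rewrite mevalM va.
Qed.

Lemma repD al be v w : rep al v -> rep be w ->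
  rep (fun p => al p + be p) (fun l => v l + w l).
Proof.
move=> [a [def_a va]] [c [def_c vc]]; exists (fun l => a l + c l); split=> [p|l].
  by rewrite def_a def_c -big_split; apply: eq_bigr => l _; rewrite mulrDl.
by rewrite mevalD va vc.
Qed.

Lemma rep_class i : rep (F i) (fun l => (l == i)%:R).
Proof.
exists (fun l => (l == i)%:R); split=> [p|l].
  rewrite (bigD1 i) //= eqxx mul1r big1 ?addr0 // => l /negbTE ->.
  by rewrite mul0r.
exact: rmorph_nat.
Qed.

(** Expanding each [g r] over the polynomial ring puts every coordinate of the sum in the ideal of
    the variables. *)
Lemma rep_ideal (g : 'I_n -> 'I_m.+1 -> {mpoly rat[n]}) : (forall r, gkm_rat (g r)) ->
  rep (fun p => \sum_r 'X_r * g r p) (fun=> 0).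
Proof.
move=> gkm_g.
have [a Ha] := boolp.choice (fun r => class_expansion (gkm_g r)).
exists (fun l => \sum_r 'X_r * a r l); split=> [p|l]; last first.
  by rewrite rmorph_sum /= big1 // => r _; rewrite mevalM mevalXU mul0r.
under [RHS]eq_bigr => l _ do rewrite mulr_suml.
rewrite exchange_big /=; apply: eq_bigr => r _; rewrite Ha mulr_sumr.
by apply: eq_bigr => l _; rewrite mulrA.
Qed.

End Class.
End Weights.
End Vertices.

(** * The Chevalley formula *)

Section Chains.
Variables (T : finType) (R : rel T) (w : T -> rat).

(** The starting point carries no weight and the endpoint does, as in the denominators
    [b_(l_1) ... b_(l_d)]. *)
Definition chain_sum d (l q : T) : rat :=
  \sum_(ch : d.-tuple T | path R l ch && (last l ch == q)) \prod_(t <- ch) w t.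

Lemma chain_sum0 l q : chain_sum 0 l q = (l == q)%:R.
Proof.
rewrite /chain_sum; have [eq_lq|neq_lq] := eqVneq l q; last first.
  by rewrite big1 // => ch; rewrite tuple0 /= (negbTE neq_lq).
rewrite (big_pred1 [tuple]) ?big_nil // => ch; rewrite tuple0 /= eq_lq eqxx.
by apply/esym/eqP; exact: val_inj.
Qed.

Lemma chain_sumS d l q :
  chain_sum d.+1 l q = \sum_(x | R l x) chain_sum d x q * w x.
Proof.
rewrite /chain_sum.
rewrite (reindex (fun u : T * d.-tuple T => [tuple of u.1 :: u.2])) /=; last first.
  exists (fun ch => (thead ch, [tuple of behead ch])) => [[x ch] _|ch _] /=.
    by congr (_, _); apply/val_inj.
  by apply/val_inj; case/tupleP: ch.
under [RHS]eq_bigr => x _ do rewrite mulr_suml.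
rewrite pair_big_dep /=; apply: eq_big => [[x ch]|[x ch] _] /=; first by rewrite andbA.
by rewrite big_cons mulrC.
Qed.

End Chains.

Section Covers.
Variable n : nat.
Implicit Types (A : {set 'I_n}).

(** Swapping two adjacent values changes the order of no pair but those two. It therefore matches
    the downward edges at [A] with those at the cover, except the edge joining the two. *)
Lemma exch_pair_tperm A (s s' : 'I_n) : s' = s.+1 :> nat -> s \in A -> s' \notin A ->
  forall x, exch_pair A x =
    exch_pair (s' |: (A :\ s)) (tperm s s' x.1, tperm s s' x.2)
    && ((tperm s s' x.1, tperm s s' x.2) != (s, s')).
Proof.
move=> def_s' sA s'A [a c]; have neq_ss : s != s'.
  by rewrite -val_eqE /= def_s' neq_ltn ltnSn.
have mem_tperm r : (tperm s s' r \in s' |: (A :\ s)) = (r \in A).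
  rewrite !inE; case: tpermP => [->|->|/eqP nrs /eqP nrs'].
  - by rewrite eqxx sA.
  - by rewrite (negbTE neq_ss) eqxx (negbTE s'A).
  - by rewrite (negbTE nrs') nrs.
have tpD r : r != s -> r != s' -> tperm s s' r = r.
  by move=> nrs nrs'; rewrite tpermD // eq_sym.
rewrite /exch_pair /= !mem_tperm.
case: (boolP (a \in A)) => //= aA; case: (boolP (c \in A)) => //= cA.
have neq_as : a != s by apply: contraNneq aA => ->.
have neq_cs' : c != s' by apply: contraTneq cA => ->.
have [eas'|nas'] := eqVneq a s'; have [ecs|ncs] := eqVneq c s.
- by rewrite eas' ecs tpermR tpermL eqxx andbF def_s' ltnNge leqnSn.
- rewrite eas' tpermR tpD // xpair_eqE eqxx (negbTE neq_cs') andbT.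
  have : (s : nat) != c by rewrite val_eqE eq_sym.
  have : (s' : nat) != c by rewrite val_eqE eq_sym.
  by lia.
- rewrite ecs tpermL tpD // xpair_eqE (negbTE neq_as) andbT.
  have : (s : nat) != a by rewrite val_eqE eq_sym.
  by lia.
- by rewrite !tpD // xpair_eqE (negbTE neq_as) andbT.
Qed.

Lemma merge_var_tperm (s s' r : 'I_n) : merge_var rat s s' (tperm s s' r) = merge_var rat s s' r.
Proof.
rewrite /merge_var; case: tpermP => [->|->|//]; last by rewrite !eqxx; case: eqP.
by rewrite eqxx; case: eqP => // ->.
Qed.

End Covers.

Section Pieri.
Variables (n k m : nat) (lam : 'I_m.+1 -> symbol n k).
Hypothesis m_bin : m.+1 = 'C(n, k).
Hypothesis lam_bij : bijective lam.
Hypothesis lam_mono : forall i j, sle (lam i) (lam j) -> (i <= j)%N.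

Local Notation A_ p := (sset (lam p)).
Local Notation Y := (Ysym_rat lam).
Local Notation one := (fun=> 1 : rat).

Section Unweighted.
Variable F : 'I_m.+1 -> 'I_m.+1 -> {mpoly rat[n]}.
Hypothesis clF : schubert_family lam one F.

Let one_neq0 (p : 'I_m.+1) : one p != 0 := oner_neq0 _.
Let one_lin p : one p = 1 + \sum_(r < k) (fun=> 0 : rat) (lam p r).
Proof. by rewrite big1 ?addr0. Qed.

Lemma wroot_rat_one l p : wroot_rat lam one l p = Y l - Y p.
Proof. by rewrite /wroot_rat divr1 scale1r. Qed.

(* [F q p] is divisible by every root at [p] except that of [q], so by degree it
   is a constant times their product; merging the two exchanged variables
   identifies it with [F q q], which forces the constant to be 1. *)
Lemma scover_class q p : scover (lam p) (lam q) -> (Y q - Y p) * F q p = F p p.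
Proof.
move=> cov; have [s [s' [def_s' sq s'q def_p]]] := scover_step cov.
have [le_qp /eqP dim_p] := andP cov.
have [gF supp diag hom] := clF.
have neq_ss : s != s' by rewrite -val_eqE /= def_s' neq_ltn ltnSn.
pose x0 := (s, s').
have inv_x0 : exch_pair (A_ p) x0.
  by rewrite /exch_pair /= def_p !inE !eqxx (negbTE neq_ss) /= def_s'.
have vertex_x0 : vertex lam (exchange (A_ p) x0) = q.
  apply/(lam_inj lam_bij)/sset_inj; rewrite (vertex_exchange m_bin lam_bij) //.
  apply/setP => r; rewrite /exchange def_p !inE /=.
  case: (eqVneq r s) => [->|_] //=; case: (eqVneq r s') => [->|] //=.
  by rewrite (negbTE s'q).
have q_in_R : q \in Rindex lam p.
  by rewrite (Rindex_exchange m_bin lam_bij) -vertex_x0; apply: imset_f.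
have def_root : Y q - Y p = 'X_s - 'X_s'.
  by rewrite -vertex_x0 (Ysym_rat_exchange m_bin lam_bij inv_x0).
have diagE l : F l l = \prod_(x | exch_pair (A_ l) x) ('X_x.1 - 'X_x.2).
  rewrite diag (prod_Rindex m_bin lam_bij); apply: eq_bigr => x inv_x.
  by rewrite wroot_rat_one (Ysym_rat_exchange m_bin lam_bij inv_x).
pose P' x := exch_pair (A_ p) x && (x != x0).
have subP' : {subset P' <= [pred x | (x.1 \notin A_ p) && (x.2 \in A_ p)]}.
  by move=> x /andP[/and3P[x1 x2 _] _]; rewrite inE x1.
suff -> : F q p = \prod_(x | P' x) ('X_x.1 - 'X_x.2).
  by rewrite diagE [RHS](bigD1 x0) //= def_root.
have [x P'x|g def_g] := dvd_prod_pairs subP' (f := F q p).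
  have /andP[inv_x neq_x] := P'x.
  pose l := vertex lam (exchange (A_ p) x).
  have lR : l \in Rindex lam p by rewrite (Rindex_exchange m_bin lam_bij); apply: imset_f.
  have := gF q l p lR; rewrite wroot_rat_one (Ysym_rat_exchange m_bin lam_bij inv_x).
  (* By dimension, a neighbour of [p] in [Rindex lam p] other than [q] cannot lie above [q]. *)
  rewrite (supp q l) ?subr0 //; apply/negP => le_ql.
  have neq_ql : lam q != lam l.
    apply: contraNneq neq_x => /(lam_inj lam_bij) eq_ql; apply/eqP.
    apply: (exchange_inj inv_x inv_x0).
    rewrite -(vertex_exchange m_bin lam_bij inv_x).
    by rewrite -(vertex_exchange m_bin lam_bij inv_x0) vertex_x0 eq_ql.
  have neq_lp : lam l != lam p.
    apply: contraTneq (Rset_lt lam_mono lR) => /(lam_inj lam_bij) ->.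
    by rewrite ltnn.
  have := slt_sdim (Rset_sle lR) neq_lp; rewrite dim_p ltnS.
  by rewrite leqNgt (slt_sdim le_ql neq_ql).
set Q := \prod_(x | P' x) _ in def_g *.
have nzQ : Q != 0.
  apply/prodf_neq0 => x /andP[/and3P[_ _ lt_x] _]; apply: mpolyXB_neq0.
  by apply: contraTneq lt_x => ->; rewrite ltnn.
(* [Q] omits one of the roots at [p], so its degree [sdim (lam q)] is already that of [F q p]. *)
have [c def_c] : exists c, g = c%:MP.
  have [->|nz_g] := eqVneq g 0; first by exists 0.
  have nz_qp : F q p != 0 by rewrite def_g mulf_neq0.
  have homQ : Q \is (sdim (lam q)).-homog.
    have -> : sdim (lam q) = #|P'|.
      have cardP : sdim (lam p) = #|exch_pair (A_ p)|.
        rewrite -(card_Rindex m_bin lam_bij one_neq0 one_lin clF).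
        rewrite (Rindex_exchange m_bin lam_bij) card_in_imset // => x y inv_x inv_y eq_xy.
        apply: (exchange_inj inv_x inv_y); rewrite -(vertex_exchange m_bin lam_bij inv_x).
        by rewrite eq_xy (vertex_exchange m_bin lam_bij inv_y).
      have : (sdim (lam q)).+1 = #|exch_pair (A_ p)| by rewrite -cardP dim_p.
      rewrite (cardD1 x0) (inv_x0 : x0 \in exch_pair (A_ p)) add1n => -[->].
      by apply: eq_card => x; rewrite !unfold_in /= andbC.
    by apply: prod_homog1 => x _; rewrite rpredB // dhomogX /= mdeg1.
  exists (g@_0); apply: msize1_polyC.
  have := msizeM nzQ nz_g; rewrite -def_g (homog_msizeE nz_qp (hom q p)).
  rewrite (homog_msizeE nzQ homQ) addSn /= => /eqP.
  by rewrite -[X in X == _]addn1 eqn_add2l => /eqP <-.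
rewrite def_g def_c; suff -> : c = 1 by rewrite mpolyC1 mulr1.
pose sg := subst (merge_var rat s s').
have nz_sgQ : sg Q != 0.
  rewrite /sg rmorph_prod /=; apply: (prod_merge_var_neq0 (A := A_ p)) => //.
  - by rewrite def_p !inE eqxx (negbTE neq_ss).
  - by rewrite def_p !inE eqxx.
  - by rewrite /P' eqxx andbF.
have sg_qp : sg (F q p) = sg Q * c%:MP by rewrite def_g def_c /sg rmorphM /= substC.
have sg_qq : sg (F q q) = sg Q.
  (* The transposition of [s] and [s'] reindexes the roots at [q] by [P'], and merging the two
     variables does not see it. *)
  rewrite diagE /sg !rmorph_prod /=.
  have h_inj : injective (fun x : 'I_n * 'I_n => (tperm s s' x.1, tperm s s' x.2)).
    by move=> [a d] [a' d'] [/perm_inj -> /perm_inj ->].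
  rewrite [RHS](reindex_inj h_inj); apply: eq_big => [x|x _] /=.
    by rewrite (exch_pair_tperm def_s' sq s'q) /P' def_p.
  by rewrite !subst_merge_varB !merge_var_tperm.
have : sg (F q p) = sg (F q q).
  apply/eqP; rewrite -subr_eq0 -rmorphB /=.
  have [h ->] := gF q q p q_in_R.
  by rewrite wroot_rat_one def_root /sg rmorphM /= subst_merge_varE mul0r.
rewrite sg_qp sg_qq -[RHS]mulr1 => /(mulfI nz_sgQ).
by move/(congr1 (meval (fun=> 0))); rewrite mevalC meval1.
Qed.

(** The difference of the two sides is a homogeneous GKM family of degree [sdim (lam q) + 1], so
    vertices up to that dimension suffice. There both sides vanish except at the covers of [q],
    which [scover_class] settles. *)
Lemma pieri_unweighted q p :
  (Y q - Y p) * F q p = \sum_(x | scover (lam x) (lam q)) F x p.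
Proof.
have [gF supp diag hom] := clF.
have lamI := lam_inj lam_bij.
have gY : gkm_rat lam one Y.
  by move=> l r _; exists (-1); rewrite wroot_rat_one mulrN1 opprB.
pose de r := (Y q - Y r) * F q r - \sum_(x | scover (lam x) (lam q)) F x r.
suff de0 : forall r, de r = 0 by exact: subr0_eq (de0 p).
apply: (homog_class_eq0 m_bin lam_bij lam_mono one_neq0 one_lin clF
  (d := (sdim (lam q)).+1)) => [||r dim_r].
- apply: gkm_ratB; last by apply: gkm_rat_sum.
  by apply: gkm_ratM => //; apply: gkm_ratB => //; apply: gkm_rat_const.
- move=> r; apply: rpredB; last first.
    by apply: rpred_sum => x /andP[_ /eqP <-]; apply: hom.
  rewrite -add1n; apply: dhomogM => //.
  by apply: rpredB; exact: Ysym_rat_homog.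
rewrite /de; have [le_qr|nle_qr] := boolP (sle (lam q) (lam r)); last first.
  rewrite supp // mulr0 big1 ?subrr // => x /andP[le_qx _]; apply: supp.
  by apply: contra nle_qr; exact: sle_trans.
have [<-|neq_qr] := eqVneq q r.
  rewrite subrr mul0r big1 ?subrr // => x /andP[_ /eqP dim_x]; apply: supp.
  by apply/negP => /sle_sdim; rewrite dim_x ltnn.
have lt_qr : (sdim (lam q) < sdim (lam r))%N.
  by apply: slt_sdim => //; rewrite (inj_eq lamI).
have cov : scover (lam r) (lam q) by rewrite /scover le_qr eqn_leq dim_r.
rewrite (scover_class cov) (bigD1 r) //= big1 ?addr0 ?subrr // => x.
case/andP=> /andP[_ /eqP dim_x] neq_xr; apply: supp; apply/negP => le_xr.
have := slt_sdim le_xr; rewrite (inj_eq lamI) dim_x => /(_ neq_xr).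
by rewrite ltnNge dim_r.
Qed.

End Unweighted.

(** * Twisting to the weighted Chevalley formula *)

Section Weighted.
Variables (B : 'I_m.+1 -> rat) (e : 'I_n -> rat).
Hypothesis B_neq0 : forall p, B p != 0.
Hypothesis B_lin : forall p, B p = 1 + \sum_(r < k) e (lam p r).
Variables F G : 'I_m.+1 -> 'I_m.+1 -> {mpoly rat[n]}.
Hypothesis clF : schubert_family lam one F.
Hypothesis clG : schubert_family lam B G.

Local Notation twist := (twist lam B e).

(** The change along an edge splits into the twist of an unweighted change, where the root is
    twisted too, and the difference of two twists of one polynomial, which is [subst_congr]. *)
Lemma gkm_rat_twist al : gkm_rat lam one al -> gkm_rat lam B (fun p => twist p (al p)).
Proof.
move=> g_al l p lp.
have -> : twist p (al p) - twist l (al l) =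
    twist p (al p - al l) + (twist p (al l) - twist l (al l)) by rewrite rmorphB addrA subrK.
apply: mdvdD.
  by rewrite -(twist_root B_neq0 B_lin) -wroot_rat_one; apply/mdvd_subst/g_al.
(* The two images of ['X_r] differ by [e r / B l] times the weighted root. *)
apply: subst_congr => r; exists ((e r / B l)%:MP).
rewrite [RHS]mulrC mul_mpolyC /wroot_rat scalerBr scalerA mulrA divfK //.
by rewrite opprB addrC addrA subrK.
Qed.

Lemma twist_homog p d f : f \is d.-homog -> twist p f \is d.-homog.
Proof.
apply: subst_homog => r; apply: rpredB; first by rewrite dhomogX /= mdeg1.
exact/rpredZ/Ysym_rat_homog.
Qed.

(** By [homog_class_eq0] it is enough to compare up to the dimension of [i]: at [i] the twist
    matches the roots, and elsewhere both families vanish by support. *)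
Lemma twist_class i p : G i p = twist p (F i p).
Proof.
have [gF suppF diagF homF] := clF; have [gG suppG diagG homG] := clG.
suff de0 : forall r, twist r (F i r) - G i r = 0 by rewrite (subr0_eq (de0 p)).
move=> {p}; apply: (homog_class_eq0 m_bin lam_bij lam_mono B_neq0 B_lin clG
  (d := sdim (lam i))) => [|p|p dim_p].
- by apply: gkm_ratB => //; apply/gkm_rat_twist/gF.
- by apply: rpredB => //; apply/twist_homog/homF.
have [->|neq_ip] := eqVneq p i.
  rewrite diagF diagG rmorph_prod /= (_ : \prod_(l in Rindex lam i) _ =
    \prod_(l in Rindex lam i) wroot_rat lam B l i) ?subrr //.
  by apply: eq_bigr => l _; rewrite wroot_rat_one twist_root.
have nle_ip : ~~ sle (lam i) (lam p).
  apply: contraL dim_p => /slt_sdim; rewrite (inj_eq (lam_inj lam_bij)) eq_sym.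
  by rewrite -ltnNge => /(_ neq_ip).
by rewrite suppF // suppG // rmorph0 subrr.
Qed.

(** The family for which [twist p 'X_r] is ['X_r + e r *: hyperplane p]. *)
Definition hyperplane p : {mpoly rat[n]} := - (B p)^-1 *: Y p.

(** The unweighted formula twisted at [p] has the factor [Y q - (B q / B p) *: Y p]; the formula is
    solved for [- (B p)^-1 *: Y p]. *)
Lemma pieri q p : hyperplane p * G q p =
  (B q)^-1%:MP * (\sum_(x | scover (lam x) (lam q)) G x p - Y q * G q p).
Proof.
have := congr1 (twist p) (pieri_unweighted clF q p).
rewrite rmorphM rmorph_sum /= (twist_root B_neq0 B_lin) -twist_class.
under eq_bigr => x _ do rewrite -twist_class.
move=> <-; rewrite /wroot_rat mulrBl addrAC subrr add0r.
rewrite mulrN mulrA mul_mpolyC scalerA mulrA mulVf // mul1r /hyperplane.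
by rewrite scaleNr mulNr.
Qed.

(** Multiplication by [hyperplane] read on coordinates modulo the variables: the coordinate at [l]
    collects those of the symbols that [l] covers. *)
Definition pieri_step (v : 'I_m.+1 -> rat) (l : 'I_m.+1) : rat :=
  \sum_(q | scover (lam l) (lam q)) v q / B q.

Lemma rep_hyperplane al v :
  rep G al v -> rep G (fun p => hyperplane p * al p) (pieri_step v).
Proof.
case=> a [def_a va].
apply: (@eq_rep _ _ _ (fun p => \sum_q a q * ((B q)^-1%:MP *
   (\sum_(x | scover (lam x) (lam q)) G x p - Y q * G q p)))
  _ (fun l => \sum_q (a q).@[fun=> 0] * ((B q)^-1 * (scover (lam l) (lam q))%:R))).
- move=> p; rewrite def_a mulr_sumr; apply: eq_bigr => q _.
  by rewrite -pieri mulrCA.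
- move=> l; rewrite /pieri_step [RHS]big_mkcond; apply: eq_bigr => q _.
  by rewrite va; case: ifP; rewrite ?mulr1 ?mulr0.
apply: rep_sum => q _; apply: (repM (a q)).
apply: (@eq_rep _ _ _ (fun p => (B q)^-1%:MP *
   (\sum_(x | scover (lam x) (lam q)) G x p + - Y q * G q p)) _
  (fun l => ((B q)^-1%:MP_[n]).@[fun=> 0] *
    (\sum_(x | scover (lam x) (lam q)) (l == x)%:R + (- Y q).@[fun=> 0] * (l == q)%:R))).
- by move=> p; rewrite mulNr.
(* The correction term of [pieri] has a coefficient without constant term, so it disappears modulo
   the variables. *)
- move=> l; rewrite mevalC mevalN; have -> : (Y q).@[fun=> 0] = 0.
    by rewrite rmorph_sum big1 // => r _; exact: mevalXU.
  rewrite oppr0 mul0r addr0; congr (_ * _).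
  have [cov|ncov] := boolP (scover (lam l) (lam q)).
    by rewrite (bigD1 l) //= eqxx big1 ?addr0 // => x /andP[_]; rewrite eq_sym => /negbTE ->.
  by rewrite big1 // => x covx; case: eqP => // elx; rewrite elx covx in ncov.
apply/repM/repD; last exact/repM/rep_class.
by apply: rep_sum => x _; exact: rep_class.
Qed.

Lemma pieri_stepZ c v : pieri_step (fun l => c * v l) =1 (fun l => c * pieri_step v l).
Proof.
by move=> l; rewrite /pieri_step mulr_sumr; apply: eq_bigr => q _; rewrite mulrA.
Qed.

Lemma eq_pieri_step v w : v =1 w -> pieri_step v =1 pieri_step w.
Proof. by move=> eq_vw l; apply: eq_bigr => q _; rewrite eq_vw. Qed.

Lemma iter_pieri_stepZ d c v :
  iter d pieri_step (fun l => c * v l) =1 (fun l => c * iter d pieri_step v l).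
Proof.
elim: d => //= d IHd l; rewrite -pieri_stepZ; exact: eq_pieri_step.
Qed.

Lemma iter_pieri_step d q l :
  iter d pieri_step (fun x => (x == q)%:R) l =
  chain_sum (fun x y => scover (lam x) (lam y)) (fun x => (B x)^-1) d l q.
Proof.
elim: d l => [|d IHd] l; first by rewrite chain_sum0.
by rewrite chain_sumS /= /pieri_step; apply: eq_bigr => x _; rewrite IHd.
Qed.

(* [f] acts after [twist], modulo the variables, as [c] times the [d]-th power
   of the class [hyperplane]. *)
Definition acts_as (f : {mpoly rat[n]}) (c : rat) (d : nat) :=
  forall al v, rep G al v ->
    rep G (fun p => twist p f * al p) (fun l => c * iter d pieri_step v l).

Lemma acts_as1 : acts_as 1 1 0.
Proof.
by move=> al v; apply: eq_rep => x; rewrite ?rmorph1 mul1r.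
Qed.

Lemma acts_asM f f' c c' d d' :
  acts_as f c d -> acts_as f' c' d' -> acts_as (f * f') (c * c') (d + d').
Proof.
move=> act act' al v rep_v; apply: eq_rep (act _ _ (act' _ _ rep_v)) => x.
  by rewrite rmorphM mulrA.
by rewrite iter_pieri_stepZ mulrA iterD.
Qed.

Lemma acts_asX f c d N : acts_as f c d -> acts_as (f ^+ N) (c ^+ N) (d * N).
Proof.
move=> act; elim: N => [|N IHN]; first by rewrite muln0; exact: acts_as1.
by rewrite !exprS mulnS; exact: acts_asM.
Qed.

(** The twist adds [e r - e r'] times [hyperplane] to ['X_r - 'X_r'], and the latter vanishes modulo
    the variables. *)
Lemma acts_as_diff r r' : acts_as ('X_r - 'X_r') (e r - e r') 1.
Proof.
move=> al v rep_v.
apply: (@eq_rep _ _ _ (fun p => ('X_r - 'X_r') * al p +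
    (e r - e r')%:MP * (hyperplane p * al p)) _
  (fun l => ('X_r - 'X_r').@[fun=> 0] * v l +
    ((e r - e r')%:MP_[n]).@[fun=> 0] * pieri_step v l)); last first.
- by apply/repD; apply: repM => //; exact: rep_hyperplane.
- by move=> l; rewrite mevalC mevalB !mevalXU subrr mul0r add0r.
move=> p; rewrite mulrA -mulrDl; congr (_ * _).
rewrite [RHS]rmorphB /= !twistX mul_mpolyC /hyperplane scalerA mulrN scaleNr mulrBl scalerBl.
by rewrite !opprB addrACA [RHS]addrACA [- 'X_r' + _]addrC.
Qed.

End Weighted.

End Pieri.

(** * Pluecker weights are affine *)

Section LinearWeights.
Variables (n k m : nat) (lam : 'I_m.+1 -> symbol n k) (b : 'I_m.+1 -> nat).
Hypothesis k_gt0 : (0 < k)%N.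
Hypothesis k_ltn : (k < n)%N.
Hypothesis m_bin : m.+1 = 'C(n, k).
Hypothesis lam_bij : bijective lam.
Hypothesis b_plucker : plucker_weight lam b.
Variable bu : 'I_n.-1 -> int.
Hypothesis bu_def : is_b_of_u lam b bu.

Local Notation A_ p := (sset (lam p)).

(** Evaluation at an indicator function turns the identity defining [bu] into statements about
    membership. *)
Lemma mem_sset_meval p z :
  (Ysym (lam p)).@[fun r => (r == z)%:R] = ((z \in A_ p)%:R : int).
Proof.
rewrite /Ysym rmorph_sum /=; under eq_bigr => r _ do rewrite mevalXU.
rewrite (big_sset (fun x => (x == z)%:R)); have [zA|zA] := boolP (z \in A_ p).
  by rewrite (bigD1 z) //= eqxx big1 ?addr0 // => x /andP[_ /negbTE ->].
by rewrite big1 // => x xA; case: eqP => // exz; rewrite -exz xA in zA.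
Qed.

(** The symbols [e] and [f] found for [bu r] differ only by [x] against [y]. The Pluecker relation
    with the sets [A_ p :\ x] and [y |: A_ e] compares that exchange with the one from [p] to
    [q]. *)
Lemma adjacent_weight (r : 'I_n.-1) p q :
  ord_cur r \in A_ p -> ord_next r \notin A_ p ->
  A_ q = ord_next r |: (A_ p :\ ord_cur r) -> (b p)%:Z - (b q)%:Z = bu r.
Proof.
set x := ord_cur r; set y := ord_next r => xp yp def_q.
have neq_xy : x != y by rewrite -val_eqE /= neq_ltn ltnSn.
have [e [f [def_u ->]]] := bu_def r.
have mem_ef z : (z == x)%:R - (z == y)%:R = (z \in A_ e)%:R - (z \in A_ f)%:R :> int.
  have := congr1 (meval (fun r => (r == z)%:R)) def_u.
  by rewrite /udiff !mevalB !mevalXU !mem_sset_meval ![_ == z]eq_sym.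
have [xe xf] : x \in A_ e /\ x \notin A_ f.
  by have := mem_ef x; rewrite eqxx (negbTE neq_xy); do 2![case: (_ \in _)].
have [ye yf] : y \notin A_ e /\ y \in A_ f.
  by have := mem_ef y; rewrite eqxx eq_sym (negbTE neq_xy); do 2![case: (_ \in _)].
have mem_e z : z != x -> z != y -> (z \in A_ e) = (z \in A_ f).
  move=> /negbTE zx /negbTE zy; have := mem_ef z; rewrite zx zy.
  by do 2![case: (_ \in _)].
have [_ plucker] := b_plucker.
suff : (b p + b f = b q + b e)%N by lia.
apply: (plucker (A_ p :\ x) (y |: A_ e) _ _ x y).
- by rewrite -[in RHS](card_sset (lam p)) (cardsD1 x (A_ p)) xp.
- by rewrite cardsU1 ye card_sset.
- by rewrite !inE eqxx xe orbT.
- by rewrite !inE eqxx eq_sym neq_xy /= yp.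
- by rewrite setD1K.
- apply/setP => z; rewrite !inE; have [->|zx] := eqVneq z x; first by rewrite (negbTE xf).
  by have [->|zy] := eqVneq z y; rewrite ?yf //= mem_e.
- by [].
apply/setP => z; rewrite !inE; have [->|zy] := eqVneq z y; first by rewrite (negbTE ye).
by [].
Qed.

Lemma card_ltn_ord j : (j <= n)%N -> #|[set y : 'I_n | (y < j)%N]| = j.
Proof.
move=> le_jn; rewrite -[RHS]card_ord -(card_imset _ (@widen_ord_inj _ _ le_jn)).
apply: eq_card => y; rewrite inE; apply/idP/imsetP => [lt_yj|[z _ ->]] //=.
by exists (Ordinal lt_yj) => //; apply/val_inj.
Qed.

(** A discrete antiderivative of [bu], normalized to vanish at the last index. *)
Definition slope (x : 'I_n) : int := \sum_(r < n.-1 | (x <= r)%N) bu r.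

Lemma slope_diff r : slope (ord_cur r) - slope (ord_next r) = bu r.
Proof.
rewrite /slope (bigD1 r) //= (eq_bigl (fun t : 'I_n.-1 => (r < t)%N)) ?addrK //.
by move=> t; rewrite ltn_neqAle andbC eq_sym.
Qed.

(* Every k-subset is carried to the initial one by moves r+1 |-> r, each of
   which changes [b] and the sum of slopes by the same amount. *)
Lemma weight_affine : exists a : int,
  forall p, (b p)%:Z = a + \sum_(x in A_ p) slope x.
Proof.
pose be p := (b p)%:Z - \sum_(x in A_ p) slope x.
pose init : {set 'I_n} := [set y : 'I_n | (y < k)%N].
have card_init : #|init| = k by apply: card_ltn_ord; apply: ltnW.
exists (be (vertex lam init)) => p.
suff <- : be p = be (vertex lam init) by rewrite subrK.
have [N] := ubnP (sdim (lam p)); elim: N p => // N IHN p lt_pN.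
(* Either a downward move is available, which lowers the dimension and keeps [be], or the set is
   closed under predecessors. *)
have [/existsP[r /andP[next_r cur_r]]|/existsPn closed] :=
  boolP [exists r : 'I_n.-1, (ord_next r \in A_ p) && (ord_cur r \notin A_ p)].
  set y := ord_next r in next_r; set x := ord_cur r in cur_r.
  have inv_xy : exch_pair (A_ p) (x, y) by rewrite /exch_pair /= next_r cur_r ltnSn.
  pose q := vertex lam (exchange (A_ p) (x, y)).
  have def_q : A_ q = exchange (A_ p) (x, y) by exact: vertex_exchange.
  have qR : q \in Rindex lam p by rewrite Rindex_exchange //; apply: imset_f.
  have neq_xy : x != y by rewrite -val_eqE /= neq_ltn ltnSn.
  have neq_qp : lam q != lam p.
    by apply: contraNneq cur_r => eq_qp; rewrite -eq_qp def_q !inE eqxx.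
  rewrite -(IHN q); last exact: leq_trans (slt_sdim (Rset_sle qR) neq_qp) _.
  rewrite /be def_q sum_exchange //= slope_diff.
  rewrite -(@adjacent_weight r q p); first by ring.
  - by rewrite def_q !inE eqxx.
  - by rewrite def_q !inE /= eqxx /= orbF eq_sym.
  rewrite def_q; apply/setP => z; rewrite !inE /= -/x -/y.
  have [->|zy] := eqVneq z y; first by rewrite next_r.
  by have [->|zx] := eqVneq z x; rewrite ?(negbTE cur_r).
suff -> : p = vertex lam init by [].
apply/(lam_inj lam_bij)/sset_inj; rewrite sset_vertex //; apply/eqP.
rewrite eqEcard card_sset card_init leqnn andbT; apply/subsetP => x xp.
(* A closed set contains everything below each of its elements, so an element at least [k] would
   bring in [k + 1] elements. *)
have down j (y z : 'I_n) : y \in A_ p -> z = (y - j)%N :> nat -> z \in A_ p.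
  move=> yp; elim: j z => [|j IHj] z def_z.
    by have -> : z = y by apply/ord_inj; rewrite def_z subn0.
  have [le_yj|lt_jy] := leqP y j.
    by apply: IHj; rewrite def_z; lia.
  have lt_zn : (z < n.-1)%N by have := ltn_ord y; rewrite def_z; lia.
  have := closed (Ordinal lt_zn); rewrite negb_and negbK.
  have -> : ord_cur (Ordinal lt_zn) = z by exact: val_inj.
  case/orP => // /negP[]; apply: IHj => /=; lia.
rewrite inE ltnNge; apply/negP => le_kx.
have : (#|[set y : 'I_n | (y < k.+1)%N]| <= #|A_ p|)%N.
  apply/subset_leq_card/subsetP => y; rewrite inE ltnS => le_yk.
  by apply: (down (x - y)%N x) => //; lia.
by rewrite card_ltn_ord // card_sset ltnn.
Qed.

Lemma linear_weights : exists e : 'I_n -> rat,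
  (forall p, (b p)%:R = 1 + \sum_(r < k) e (lam p r)) /\
  (forall r, e (ord_cur r) - e (ord_next r) = (bu r)%:~R).
Proof.
have [a def_b] := weight_affine.
(* The surplus [a - 1] over the required constant 1 is spread evenly over the [k] entries;
   differences are unaffected. *)
exists (fun x => (slope x)%:~R + (a%:~R - 1) / k%:R); split=> [p|r]; last first.
  by rewrite opprD addrACA subrr addr0 -slope_diff rmorphB.
rewrite big_split /= sumr_const card_ord -[_ / _ *+ k]mulr_natr divfK; last first.
  by rewrite pnatr_eq0 -lt0n.
have := congr1 (intr : int -> rat) (def_b p); rewrite rmorphD rmorph_sum /=.
rewrite -pmulrn => ->; rewrite -(big_sset (fun x => (slope x)%:~R : rat)); ring.
Qed.

End LinearWeights.

(** * From the cohomology rings to rational families *)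

Definition mpoly_rat n : {mpoly int[n]} -> {mpoly rat[n]} := map_mpoly (intr : int -> rat).

HB.instance Definition _ n := GRing.RMorphism.copy (@mpoly_rat n)
  (map_mpoly (intr : int -> rat)).

Section RationalCoefficients.
Variable n : nat.

Lemma mpoly_ratX (r : 'I_n) : mpoly_rat 'X_r = 'X_r.
Proof. exact: map_mpolyX. Qed.

Lemma mpoly_rat_homog d (f : {mpoly int[n]}) : f \is d.-homog -> mpoly_rat f \is d.-homog.
Proof.
move=> /dhomogP homf; apply/dhomogP => m; rewrite mcoeff_msupp mcoeff_map_mpoly => nz.
by apply: homf; rewrite mcoeff_msupp; apply: contraNneq nz => ->.
Qed.

End RationalCoefficients.

Section Restriction.
Variables (n k m : nat) (lam : 'I_m.+1 -> symbol n k) (b : 'I_m.+1 -> nat).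
Hypothesis b_dvd : forall l p, l \in Rindex lam p -> (b p %| b l)%N.
Hypothesis b_gt0 : forall p, (0 < b p)%N.

Local Notation B := (fun p => (b p)%:R : rat).

Definition restr_rat (p : 'I_m.+1) (al : HT lam b) : {mpoly rat[n]} := mpoly_rat (restr al p).

Lemma restr_ratM p al be : restr_rat p (al * be) = restr_rat p al * restr_rat p be.
Proof. by rewrite /restr_rat /restr rmorphM ffunE rmorphM. Qed.

Lemma restr_ratB p al be : restr_rat p (al - be) = restr_rat p al - restr_rat p be.
Proof. by rewrite /restr_rat /restr rmorphB !ffunE rmorphB. Qed.

HB.instance Definition _ p := GRing.isZmodMorphism.Build _ _ (restr_rat p) (restr_ratB p).

Lemma restr_rat_sum p (I : finType) (P : pred I) (al : I -> HT lam b) :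
  restr_rat p (\sum_(i | P i) al i) = \sum_(i | P i) restr_rat p (al i).
Proof. exact: raddf_sum. Qed.

Lemma restr_ratMz p al (c : int) : restr_rat p (al *~ c) = restr_rat p al *~ c.
Proof. exact: raddfMz. Qed.

Lemma restr_rat_const p f : restr_rat p (HTconst lam b f) = mpoly_rat f.
Proof. by rewrite /restr_rat /restr ffunE. Qed.

Lemma mpoly_rat_Ysym p : mpoly_rat (Ysym (lam p)) = Ysym_rat lam p.
Proof. by rewrite rmorph_sum; apply: eq_bigr => r _; exact: mpoly_ratX. Qed.

(** Divisibility along the edge makes the natural number quotient in [wroot] the true ratio. *)
Lemma mpoly_rat_wroot l p : l \in Rindex lam p -> mpoly_rat (wroot lam b l p) = wroot_rat lam B l p.
Proof.
move=> lp; rewrite rmorphB rmorphM /= !mpoly_rat_Ysym rmorph_nat /wroot_rat.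
have -> : (b l)%:R / (b p)%:R = (b l %/ b p)%:R :> rat.
  by rewrite -{1}(divnK (b_dvd lp)) natrM mulfK // pnatr_eq0 -lt0n.
by rewrite scaler_nat mulr_natl.
Qed.

Lemma restr_rat_gkm al : gkm_rat lam B (fun p => restr_rat p al).
Proof.
move=> l p lp; have /asboolP gkm_al := valP al.
have [|g def_g] := gkm_al l p; first by rewrite inE in lp.
exists (mpoly_rat g); rewrite -(mpoly_rat_wroot lp) -rmorphM -def_g rmorphB.
by [].
Qed.

Variable S : 'I_m.+1 -> HT lam b.
Hypothesis S_schubert : forall i, is_schubert_class i (S i).

Lemma restr_rat_class : schubert_family lam B (fun i p => restr_rat p (S i)).
Proof.
split=> [i|i p nle_ip|i|i p].
- exact: restr_rat_gkm.
- have [supp _ _] := S_schubert i; have := contraNeq (supp p).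
  by move=> /(_ nle_ip) /= eq0; rewrite /restr_rat eq0 rmorph0.
- have [_ diag _] := S_schubert i; rewrite /restr_rat diag rmorph_prod /=.
  by apply: eq_big => [l|l lp]; [rewrite [RHS]inE | apply: mpoly_rat_wroot; rewrite inE].
- by have [_ _ hom] := S_schubert i; apply: mpoly_rat_homog.
Qed.

Variables (m_bin : m.+1 = 'C(n, k)) (lam_bij : bijective lam)
  (lam_mono : forall i j, sle (lam i) (lam j) -> (i <= j)%N)
  (e : 'I_n -> rat) (B_lin : forall p, B p = 1 + \sum_(r < k) e (lam p r)).

(** An equality in the quotient ring lifts to one in [HT] up to a combination of the variables,
    which has zero coordinates by [rep_ideal]. Uniqueness of coordinates then identifies the
    constants. *)
Lemma structure_constantsE c i j l v : structure_constants S c ->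
  rep (fun i p => restr_rat p (S i)) (fun p => restr_rat p (S i) * restr_rat p (S j)) v ->
  (sdim (lam l) = sdim (lam i) + sdim (lam j))%N -> (c i j l)%:~R = v l.
Proof.
move=> c_def rep_ij dim_l.
have B_neq0 p : B p != 0 by rewrite pnatr_eq0 -lt0n.
pose P := [pred l | (sdim (lam l) == sdim (lam i) + sdim (lam j))%N].
have [g def_g] : exists g : 'I_n -> HT lam b,
    S i * S j - \sum_(l | P l) S l *~ c i j l = \sum_(r < n) HTconst lam b 'X_r * g r.
  apply/asboolP.
  have xi_eq : xi lam b (S i * S j) = xi lam b (\sum_(l | P l) S l *~ c i j l).
    rewrite rmorphM c_def rmorph_sum; apply: eq_bigr => x _.
    by rewrite rmorphMz.
  have : S i * S j - \sum_(l | P l) S l *~ c i j l \in yI lam b.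
    by rewrite Quotient.idealrBE; apply/eqP.
  by [].
pose F := fun i p => restr_rat p (S i).
have rep_g : rep F (fun p => \sum_r 'X_r * restr_rat p (g r)) (fun=> 0).
  apply: (rep_ideal m_bin lam_bij lam_mono B_neq0 B_lin restr_rat_class) => r.
  exact: restr_rat_gkm.
have rep_sum : rep F (fun p => \sum_(l | P l) (c i j l)%:~R%:MP * restr_rat p (S l))
    (fun l => \sum_(x | P x) ((c i j x)%:~R%:MP_[n]).@[fun=> 0] * (l == x)%:R).
  by apply: rep_sum => x _; apply/repM/rep_class.
have rep_c := repD rep_sum rep_g.
rewrite -(rep_fun m_bin lam_bij lam_mono B_neq0 B_lin restr_rat_class
  (eq_rep _ (fun=> erefl) rep_c) rep_ij) => [|p /=].
  rewrite addr0 (bigD1 l) /=; last by rewrite dim_l.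
  rewrite eqxx mulr1 mevalC big1 ?addr0 // => x /andP[_].
  by rewrite eq_sym => /negbTE ->; rewrite mulr0.
have := congr1 (restr_rat p) def_g; rewrite restr_ratB restr_ratM !restr_rat_sum => /eqP.
rewrite subr_eq => /eqP ->; rewrite [RHS]addrC; congr (_ + _); apply: eq_bigr => x _.
  by rewrite restr_ratMz mul_mpolyC scaler_int.
by rewrite restr_ratM restr_rat_const mpoly_ratX.
Qed.

End Restriction.

(** * Assembling the formula *)

Lemma chain_sum_eq0 n k m (lam : 'I_m.+1 -> symbol n k) (w : 'I_m.+1 -> rat) d l q :
  ~~ sle (lam q) (lam l) ->
  chain_sum (fun x y => scover (lam x) (lam y)) w d l q = 0.
Proof.
elim: d l => [|d IHd] l nle_ql.
  by rewrite chain_sum0; case: eqP nle_ql => // ->; rewrite sle_refl.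
rewrite chain_sumS big1 // => x /andP[le_xl _]; rewrite IHd ?mul0r //.
by apply: contra nle_ql => le_qx; exact: sle_trans le_qx le_xl.
Qed.

Lemma DtermE n k m (lam : 'I_m.+1 -> symbol n k) (b : 'I_m.+1 -> nat) Cb i j l q :
  Dterm lam b Cb i j l q = (Cb i j q)%:~R *
    chain_sum (fun x y => scover (lam x) (lam y)) (fun x => (b x)%:R^-1)
      (sdim (lam l) - sdim (lam q)) l q.
Proof.
by rewrite /Dterm /chain_sum mulr_sumr; apply: eq_bigr => ch _; rewrite prodfV.
Qed.

Lemma divisive_dvd m (b : 'I_m.+1 -> nat) : divisive_order b ->
  forall i j : 'I_m.+1, (i <= j)%N -> (b j %| b i)%N.
Proof.
move=> b_div i [j lt_j] /=; elim: j lt_j => [|j IHj] lt_j.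
  by rewrite leqn0 => /eqP i0; rewrite (_ : Ordinal lt_j = i) //; apply/val_inj.
rewrite leq_eqVlt => /orP[/eqP def_i|lt_ij].
  by rewrite (_ : Ordinal lt_j = i) //; apply/val_inj.
exact: dvdn_trans (b_div (Ordinal (ltnW lt_j)) (Ordinal lt_j) erefl) (IHj (ltnW lt_j) lt_ij).
Qed.

Theorem theoremE (n k m : nat) (k_gt0 : (0 < k)%N) (k_ltn : (k < n)%N)
  (m_bin : m.+1 = 'C(n, k))
  (lam : 'I_m.+1 -> symbol n k) (lam_bij : bijective lam)
  (lam_mono : forall i j, sle (lam i) (lam j) -> (i <= j)%N)
  (b : 'I_m.+1 -> nat) (b_plucker : plucker_weight lam b)
  (b_div : divisive_order b)
  (bS : 'I_m.+1 -> HT lam b)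
  (bS_schubert : forall i, is_schubert_class i (bS i))
  (S : 'I_m.+1 -> HT lam (fun=> 1%N))
  (S_schubert : forall i, is_schubert_class i (S i))
  (bC : 'I_m.+1 -> 'I_m.+1 -> 'I_m.+1 -> int)
  (bC_def : structure_constants bS bC)
  (C : 'I_m.+1 -> 'I_m.+1 -> 'I_m.+1 -> int)
  (C_def : structure_constants S C)
  (Ct : 'I_m.+1 -> 'I_m.+1 -> 'I_m.+1 -> {mpoly int[n]})
  (Ct_def : equiv_structure_constants S Ct)
  (K : 'I_m.+1 -> 'I_m.+1 -> 'I_m.+1 -> 'X_{1..n.-1} -> nat)
  (K_def : knutson_tao_expansion lam Ct K)
  (bu : 'I_n.-1 -> int) (bu_def : is_b_of_u lam b bu)
  (i j l : 'I_m.+1)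
  (hd : (sdim (lam i) + sdim (lam j) = sdim (lam l))%N) :
  (bC i j l)%:~R = (C i j l)%:~R
    + \sum_(q | [&& slt (lam q) (lam l), sle (lam i) (lam q)
                  & sle (lam j) (lam q)])
        Dterm lam b (Ceval lam K bu) i j l q :> rat.
Proof.
have [b_gt0 _] := b_plucker.
have b_dvd x p : x \in Rindex lam p -> (b p %| b x)%N.
  by move=> /(Rset_lt lam_mono)/ltnW; exact: divisive_dvd.
have [e [b_lin e_diff]] := linear_weights k_gt0 k_ltn m_bin lam_bij b_plucker bu_def.
have b_neq0 p : (b p)%:R != 0 :> rat by rewrite pnatr_eq0 -lt0n.
have one_lin (p : 'I_m.+1) : 1 = 1 + \sum_(r < k) (fun=> 0 : rat) (lam p r).
  by rewrite big1 ?addr0.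
pose F x p := restr_rat p (S x); pose G x p := restr_rat p (bS x).
have clF : schubert_family lam (fun=> 1) F by exact: restr_rat_class.
have clG : schubert_family lam (fun p => (b p)%:R) G by exact: restr_rat_class.
pose U (R : 'X_{1..n.-1}) : {mpoly rat[n]} :=
  \prod_(r < n.-1) ('X_(ord_cur r) - 'X_(ord_next r)) ^+ R r.
have mpoly_rat_Umon R : mpoly_rat (Umon R) = U R.
  rewrite rmorph_prod; apply: eq_bigr => r _.
  by rewrite rmorphXn rmorphB /= !mpoly_ratX.
pose D q (R : 'X_{1..n.-1 < (sdim (lam i) + sdim (lam j)).+1}) :=
  (mdeg R + sdim (lam q) == sdim (lam i) + sdim (lam j))%N.
have mpoly_rat_Ct q : mpoly_rat (Ct i j q) = \sum_(R | D q R) (K i j q R)%:R * U R.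
  rewrite K_def rmorph_sum; apply: eq_bigr => R _.
  by rewrite rmorphM rmorph_nat /= mpoly_rat_Umon.
have prodF p : F i p * F j p = \sum_q mpoly_rat (Ct i j q) * F q p.
  rewrite /F -restr_ratM Ct_def restr_rat_sum; apply: eq_bigr => q _.
  by rewrite restr_ratM restr_rat_const.
have Ceval_eq0 q : ~~ (sle (lam i) (lam q) && sle (lam j) (lam q)) ->
    Ceval lam K bu i j q = 0.
  move=> nle_q; suff Ct0 : mpoly_rat (Ct i j q) = 0.
    apply/eqP; rewrite -(intr_eq0 rat); apply/eqP.
    (* At the point [e] each [u_r] takes the value [bu r], so [Ceval] is the value of [Ct] there. *)
    have := congr1 (meval e) Ct0; rewrite mpoly_rat_Ct meval0 => <-.
    rewrite /Ceval !rmorph_sum; apply: eq_bigr => R _.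
    rewrite !rmorphM !rmorph_nat !rmorph_prod /=; congr (_ * _).
    apply: eq_bigr => r _.
    by rewrite !rmorphXn /= mevalB !mevalXU e_diff.
  (* Restrict the product to [q], where it vanishes. Terms of symbols strictly below [q] vanish by
     induction and the others by support, so the nonzero diagonal value of [F q] forces the
     coefficient to vanish. *)
  have [N] := ubnP (val q); elim: N q nle_q => // N IHN q nle_q lt_qN.
  have [_ supp _ _] := clF; have := prodF q.
  have -> : F i q * F j q = 0.
    by case/nandP: nle_q => nle_q; rewrite (supp _ _ nle_q) ?mul0r ?mulr0.
  rewrite (bigD1 q) //= big1 ?addr0 => [/esym/eqP|x neq_xq].
    rewrite mulf_eq0 => /orP[/eqP //|].
    have := class_diag_neq0 m_bin lam_bij (e := fun=> 0) (fun=> oner_neq0 _) one_lin clF q.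
    by move=> /negbTE ->.
  have [le_xq|nle_xq] := boolP (sle (lam x) (lam q)); last by rewrite supp ?mulr0.
  rewrite IHN ?mul0r //.
    apply: contra nle_q => /andP[le_ix le_jx].
    by rewrite (sle_trans le_ix le_xq) (sle_trans le_jx le_xq).
  apply: leq_trans (lt_qN : (q <= N)%N).
  by rewrite ltn_neqAle lam_mono // andbT.
(* When dimensions add up only the empty multiset contributes, and the equivariant constant is an
   integer that [xi] and [Ceval] both return. *)
have C_eq : C i j l = Ceval lam K bu i j l.
  apply/eqP; rewrite -(eqr_int rat); apply/eqP.
  rewrite (@structure_constantsE _ _ _ _ _ _ _ S S_schubert m_bin lam_bij lam_mono
    (fun=> 0) one_lin C i j l (fun q => (mpoly_rat (Ct i j q)).@[fun=> 0])) //.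
    rewrite mpoly_rat_Ct /Ceval !rmorph_sum; apply: eq_bigr => R /eqP dim_R.
    have /eqP := etrans dim_R hd.
    rewrite -[X in _ == X]add0n eqn_add2r mdeg_eq0 => /eqP R0.
    rewrite !rmorphM !rmorph_nat !rmorph_prod /=; congr (_ * _).
    by apply: eq_bigr => r _; rewrite R0 mnm0E !expr0 rmorph1.
  by exists (fun q => mpoly_rat (Ct i j q)).
have actsU R : acts_as lam (fun p => (b p)%:R) e G (U R)
    (\prod_(r < n.-1) (bu r)%:~R ^+ R r) (mdeg R).
  rewrite mdegE /U; elim/big_rec3: _ => [|r d c f _ IH]; first exact: acts_as1.
  apply: acts_asM IH; rewrite -[R r in X in acts_as _ _ _ _ _ _ X]mul1n.
  by apply: acts_asX; rewrite -e_diff; 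
  exact: (acts_as_diff m_bin lam_bij lam_mono b_neq0 b_lin clF clG).
have rep_bS : rep G (fun p => G i p * G j p) (fun x => \sum_q \sum_(R | D q R)
    (K i j q R)%:R * ((\prod_(r < n.-1) (bu r)%:~R ^+ R r) *
    iter (mdeg R) (pieri_step lam (fun p => (b p)%:R)) (fun y => (y == q)%:R) x)).
  have psiG := twist_class m_bin lam_bij lam_mono b_neq0 b_lin clF clG.
  apply: (@eq_rep _ _ _ (fun p => \sum_q \sum_(R | D q R) (K i j q R)%:R%:MP *
     (twist lam (fun p => (b p)%:R) e p (U R) * G q p)) _
    (fun x => \sum_q \sum_(R | D q R) ((K i j q R)%:R%:MP_[n]).@[fun=> 0] *
      ((\prod_(r < n.-1) (bu r)%:~R ^+ R r) *
    iter (mdeg R) (pieri_step lam (fun p => (b p)%:R)) (fun y => (y == q)%:R) x))).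
  - move=> p; rewrite (psiG i) (psiG j) -rmorphM prodF rmorph_sum; apply: eq_bigr => q _.
    rewrite rmorphM /= -psiG mpoly_rat_Ct rmorph_sum mulr_suml; apply: eq_bigr => R _.
    by rewrite mulrA rmorphM !rmorph_nat.
  - move=> x; apply: eq_bigr => q _; apply: eq_bigr => R _.
    by rewrite mevalC.
  by do 2![apply: rep_sum => ? _]; apply/repM/actsU/rep_class.
rewrite (structure_constantsE b_dvd b_gt0 bS_schubert m_bin lam_bij lam_mono
  b_lin bC_def rep_bS) //.
transitivity (\sum_q Dterm lam b (Ceval lam K bu) i j l q).
  apply: eq_bigr => q _; rewrite DtermE /Ceval rmorph_sum mulr_suml.
  apply: eq_bigr => R /eqP dim_R.
  (* The degree of [R] is the dimension gap from [q] to [l], that is, the length of the chains. *)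
  have {}dim_R := etrans dim_R hd; rewrite -dim_R addnK iter_pieri_step mulrA; congr (_ * _).
  rewrite rmorphM rmorph_nat rmorph_prod; congr (_ * _).
  by apply: eq_bigr => r _; rewrite rmorphXn.
(* At [q = l] the only chain is the empty one, which yields the unweighted constant. *)
rewrite (bigD1 l) //= [X in X + _](_ : _ = (C i j l)%:~R); last first.
  by rewrite DtermE subnn chain_sum0 eqxx mulr1 C_eq.
congr (_ + _); rewrite [LHS]big_mkcond [RHS]big_mkcond; apply: eq_bigr => q _.
rewrite /slt (inj_eq (lam_inj lam_bij)) DtermE.
have [->|neq_ql] := eqVneq q l; first by rewrite andbF.
(* Symbols not below [l] are reached by no chain; those not above both [i] and [j] have zero
   [Ceval]. *)
have [le_ql|nle_ql] := boolP (sle (lam q) (lam l)); last first.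
  by rewrite chain_sum_eq0 ?mulr0.
by case: ifPn => //= /Ceval_eq0 ->; rewrite mul0r.
Qed.
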